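(* A computable equivalence structure $\mathcal{A}$ is weakly ultrahomogeneous if and only if $\mathcal{A}$ is computably categorical.
   Context: Structures are countable. An equivalence structure is a set $A$ with a single equivalence relation $E$; it is computable if $A$ is a computable subset of $\omega$ and $E$ is computable. A computable structure is computably categorical if every computable structure isomorphic to it is isomorphic to it by a computable isomorphism. $\mathcal{A}$ is weakly ultrahomogeneous if there is a finite set $\{a_1,\dots,a_n\}\subseteq A$ such that every isomorphism between finite substructures of $\mathcal{A}$ containing all $a_i$ and fixing each $a_i$ extends to an automorphism of $\mathcal{A}$. *)

(* Defs.v *)
From HB Require Import structures.
From mathcomp Require Import all_boot.

Set Implicit Arguments.
Unset Strict Implicit.
Unset Printing Implicit Defensive.

(* Codes for Kleene's partial (mu-)recursive functions.  Codes carry no arity: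
   they act on finite lists of arguments, a missing argument being read as 0
   and a superfluous one being ignored by the basic functions. *)
Inductive code : Type :=
| Zero
| Succ
| Proj of nat
| Comp of code & seq code
| Prec of code & code
| Mu of code.

(* [eval c xs y]: the partial function coded by [c] is defined at [xs] with
   value [y].  In [Prec] and [Mu] the recursion (resp. search) variable is the
   first argument:
     Prec f g (0, xs)   = f xs
     Prec f g (n+1, xs) = g (n, Prec f g (n, xs), xs)
     Mu f xs            = the least y such that f (y, xs) = 0,
                          f (z, xs) being defined for every z < y. *)
Fixpoint eval (c : code) : seq nat -> nat -> Prop :=
  match c with
  | Zero => fun _ y => y = 0
  | Succ => fun xs y => y = (head 0 xs).+1
  | Proj i => fun xs y => y = nth 0 xs i
  | Comp f gs => fun xs y =>
      exists2 ys : seq nat,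
        (fix evals (gs : seq code) (ys : seq nat) : Prop :=
           match gs, ys with
           | [::], [::] => True
           | g :: gs', v :: ys' => eval g xs v /\ evals gs' ys'
           | _, _ => False
           end) gs ys
        & eval f ys y
  | Prec f g => fun xs =>
      (fix rec (n : nat) (y : nat) : Prop :=
         match n with
         | 0 => eval f (behead xs) y
         | n'.+1 => exists2 v, rec n' v & eval g [:: n', v & behead xs] y
         end) (head 0 xs)
  | Mu f => fun xs y =>
      eval f (y :: xs) 0 /\ (forall z, z < y -> exists v, eval f (z :: xs) v.+1)
  end.

Definition computes (c : code) (xs : seq nat) (y : nat) : Prop :=
  forall z, eval c xs z <-> z = y.

Definition computable_set (D : pred nat) : Prop :=
  exists c, forall x, computes c [:: x] (D x).

Definition computable_rel (R : rel nat) : Prop :=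
  exists c, forall x y, computes c [:: x; y] (R x y).

(* [f] agrees on [D] with a partial recursive function defined on [D]. *)
Definition computable_on (D : pred nat) (f : nat -> nat) : Prop :=
  exists c, forall x, x \in D -> computes c [:: x] (f x).

Record eqstruct : Type := EqStruct {
  dom : pred nat;
  erel : rel nat;
  erel_dom : forall x y, erel x y -> (x \in dom) && (y \in dom);
  erel_equiv : {in dom & &, equivalence_rel erel}
}.

Definition computable_struct (A : eqstruct) : Prop :=
  computable_set (dom A) /\ computable_rel (erel A).

(* The values of [f] outside [dom A] are irrelevant. *)
Definition is_iso (A B : eqstruct) (f : nat -> nat) : Prop :=
  [/\ forall x, x \in dom A -> f x \in dom B,
      {in dom A &, injective f},
      forall y, y \in dom B -> exists2 x, x \in dom A & f x = y
    & forall x y, x \in dom A -> y \in dom A ->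
        erel B (f x) (f y) = erel A x y].

Definition isomorphic (A B : eqstruct) : Prop := exists f, is_iso A B f.

Definition computably_isomorphic (A B : eqstruct) : Prop :=
  exists2 f, is_iso A B f & computable_on (dom A) f.

Definition computably_categorical (A : eqstruct) : Prop :=
  forall B : eqstruct,
    computable_struct B -> isomorphic B A -> computably_isomorphic B A.

Definition substructure (B A : eqstruct) : Prop :=
  (forall x, x \in dom B -> x \in dom A) /\
  (forall x y, x \in dom B -> y \in dom B -> erel B x y = erel A x y).

Definition finite_struct (B : eqstruct) : Prop :=
  exists s : seq nat, dom B =i s.

Definition weakly_ultrahomogeneous (A : eqstruct) : Prop :=
  exists2 s : seq nat, (forall a, a \in s -> a \in dom A) &
    forall (B C : eqstruct) (f : nat -> nat),
      substructure B A -> finite_struct B ->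
      substructure C A -> finite_struct C ->
      (forall a, a \in s -> (a \in dom B) && (a \in dom C)) ->
      is_iso B C f ->
      (forall a, a \in s -> f a = a) ->
      exists2 g, is_iso A A g & (forall x, x \in dom B -> g x = f x).

(* Main.v *)
Require Import Defs.
From mathcomp Require Import all_boot zify.
From Stdlib Require Import Classical IndefiniteDescription.

(** Both properties say that all classes outside a finite set of classes have
the same size; [almost_uniform] states this, the exceptional classes being
those that meet a finite list.

If [A] is weakly ultrahomogeneous over [s] and [f] is an isomorphism from [B]
onto [A], then a finite partial isomorphism from [B] to [A] that extends the
inverse of [f] on [s] becomes, after composition with the inverse of [f], a
finite partial isomorphism of [A] that fixes [s]; it extends to an automorphism
of [A], hence the given map extends to an isomorphism from [B] onto [A].  So no
finite extension is ever wrong, and a blind search for the next pair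
([back_and_forth]) builds a computable isomorphism.  The same search proves
that an almost uniform structure is weakly ultrahomogeneous: there, the next
pair exists by counting elements in a class, or classes
([partial_iso_forth]).

For the converse, let [A] be computable and not almost uniform.  Then there is
a set of allowed bounds [n], either all numbers or an initial segment, such
that for each allowed [n] infinitely many classes have more than [n] elements,
while any finite number of classes of size at most [n] exists for some allowed
[n] ([not_almost_uniform]).  A computable copy of [A] on all of the natural
numbers is built as the limit of finite injective sequences [H s] of elements
of [A], the [x]-th entry being the current image of [x].  The relation of the
copy is decided as soon as its arguments have an image, and it never changes;
so a block of equivalent numbers may be redirected to a larger class of [A],
and it can only grow.

To defeat the [e]-th partial computable function [phi] as an isomorphism from
the copy onto [A], take a candidate: an allowed [n] and [2e+1] inequivalent
elements of [A] with classes of at most [n] elements, as far as can be seen.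
When [phi x] is found to be one of them, the block of [x] is redirected to a
class of more than [n] elements and is at once given more than [n] elements.
This cannot be undone, so each candidate is used at most once; and the least
candidate not yet refuted is eventually constant.  Hence each [e] acts finitely
often, without any injury between different [e].  The images converge because
[e] may not move a block that contains a number below [e] or whose image
contains an element below [e] ([blocked]).  There are at most [2e] such blocks,
so if [phi] is an isomorphism, one of its [2e+1] preimages of the final
candidate can be moved, which contradicts the size of its image
([copy_not_computably_isomorphic]).

Two effective tools carry this: total computable functions between types that
are coded by numbers, closed under search and recursion ([cf], [cf_search]),
and a computable stagewise enumeration of all values of all programs
([facts]), which plays the role of a universal program. *)

Set Implicit Arguments.
Unset Strict Implicit.
Unset Printing Implicit Defensive.

(** * Programs *)

(** The anonymous inner recursion of [eval] at [Comp], in pointwise form. *)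
Lemma evalsP (xs : seq nat) gs ys :
  (fix evals (gs : seq code) (ys : seq nat) : Prop :=
     match gs, ys with
     | [::], [::] => True
     | g :: gs', v :: ys' => eval g xs v /\ evals gs' ys'
     | _, _ => False
     end) gs ys <->
  size gs = size ys /\
  forall k, k < size gs -> eval (nth Zero gs k) xs (nth 0 ys k).
Proof.
elim: gs ys => [|g gs IH] [|y ys] //=; try by split=> // -[].
rewrite IH; split=> [[Hg [-> H]]|[[-> H]]].
  by split=> // -[|k] //; exact: H.
by split; [exact: (H 0)|split=> // k; exact: (H k.+1)].
Qed.

Lemma eval_comp f gs xs z : eval (Comp f gs) xs z <->
  exists2 ys, size gs = size ys /\
    (forall k, k < size gs -> eval (nth Zero gs k) xs (nth 0 ys k))
    & eval f ys z.
Proof. by split=> -[ys /evalsP H1 H2]; exists ys => //; apply/evalsP. Qed.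

Lemma computes_comp f gs xs ys z :
  size gs = size ys ->
  (forall k, k < size gs -> computes (nth Zero gs k) xs (nth 0 ys k)) ->
  computes f ys z -> computes (Comp f gs) xs z.
Proof.
move=> sz Hg Hf v; rewrite eval_comp; split=> [[ys' [sz' H] Hv]|->].
  suff E : ys' = ys by rewrite E in Hv; exact/Hf.
  apply: (@eq_from_nth _ 0) => [|i]; rewrite -sz' // => lti.
  by apply/(Hg i lti); exact: H.
by exists ys; [split=> // k /Hg Hk; apply/Hk|exact/Hf].
Qed.

Lemma comp1 f g xs y z : computes f [:: y] z -> computes g xs y ->
  computes (Comp f [:: g]) xs z.
Proof. by move=> Hf Hg; apply: computes_comp Hf => // -[]. Qed.

Lemma comp2 f g h xs y1 y2 z : computes f [:: y1; y2] z -> computes g xs y1 ->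
  computes h xs y2 -> computes (Comp f [:: g; h]) xs z.
Proof. by move=> Hf Hg Hh; apply: computes_comp Hf => // -[|[]]. Qed.

Lemma computes_proj i xs : computes (Proj i) xs (nth 0 xs i).
Proof. by []. Qed.

Lemma computes_succ x xs : computes Succ (x :: xs) x.+1.
Proof. by []. Qed.

Lemma computes_prec f g xs F : computes f xs (F 0) ->
  (forall k, computes g [:: k, F k & xs] (F k.+1)) ->
  forall n, computes (Prec f g) (n :: xs) (F n).
Proof.
move=> H0 HS; elim=> [|n IH] z; first exact: H0.
split=> [[v Hv]|->].
  have -> : v = F n by apply/IH.
  by move/HS.
by exists (F n); [exact/IH|exact/HS].
Qed.

Lemma computes_mu f xs F m : (forall y, computes f (y :: xs) (F y)) ->
  F m = 0 -> (forall z, z < m -> 0 < F z) -> computes (Mu f) xs m.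
Proof.
move=> H Fm Fz y; split=> [[H0 Hlt]|->] /=.
  have Fy : F y = 0 by symmetry; apply/H.
  case: (ltngtP y m) => // [lt|lt]; first by move: (Fz _ lt); rewrite Fy.
  by have [v /H] := Hlt _ lt; rewrite Fm.
split=> [|z lt]; first by apply/H.
by exists (F z).-1; apply/H; rewrite prednK // Fz.
Qed.

Fixpoint const_code n := if n is m.+1 then Comp Succ [:: const_code m] else Zero.

Lemma computes_const n xs : computes (const_code n) xs n.
Proof. by elim: n => //= n IH; apply: comp1 IH. Qed.

Definition add_code := Prec (Proj 0) (Comp Succ [:: Proj 1]).

Lemma computes_add m n : computes add_code [:: m; n] (m + n).
Proof.
apply: (computes_prec (F := fun m => m + n)) => // k.
by apply: comp1; [exact: computes_succ|exact: computes_proj].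
Qed.

Definition pred_code := Prec Zero (Proj 0).

Lemma computes_pred n : computes pred_code [:: n] n.-1.
Proof. by apply: (computes_prec (F := predn)). Qed.

Definition sub_code :=
  Comp (Prec (Proj 0) (Comp pred_code [:: Proj 1])) [:: Proj 1; Proj 0].

Lemma computes_sub m n : computes sub_code [:: m; n] (m - n).
Proof.
apply: comp2; [|exact: computes_proj|exact: computes_proj].
apply: (computes_prec (F := fun n => m - n)) => [|k]; first by rewrite subn0.
by rewrite subnS; apply: comp1; [exact: computes_pred|exact: computes_proj].
Qed.

(** * Codings by natural numbers *)

Fixpoint tri n := if n is m.+1 then (tri m + m.+1) else 0.

Definition tri_code :=
  Prec Zero (Comp add_code [:: Proj 1; Comp Succ [:: Proj 0]]).

Lemma computes_tri n : computes tri_code [:: n] (tri n).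
Proof.
apply: (computes_prec (F := tri)) => // k.
apply: comp2; [exact: computes_add|exact: computes_proj|].
by apply: comp1; [exact: computes_succ|exact: computes_proj].
Qed.

Lemma tri_mono m n : m <= n -> tri m <= tri n.
Proof.
move=> le; rewrite -(subnK le); elim: (n - m) => // k IH.
by rewrite addSn /=; apply: leq_trans IH _; exact: leq_addr.
Qed.

Definition cpair a b := tri (a + b) + b.

Lemma diag_ex z : exists w, z < tri w.+1.
Proof. by exists z => /=; lia. Qed.

(** The antidiagonal on which [z] lies in the Cantor enumeration of pairs. It is
defined by a search, so that [Mu] computes it literally. *)
Definition diag z := ex_minn (diag_ex z).

Definition csnd z := z - tri (diag z).
Definition cfst z := diag z - csnd z.

Lemma diagP z w : tri w <= z -> z < tri w.+1 -> diag z = w.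
Proof.
rewrite /diag; case: ex_minnP => m Hm min le lt.
apply/eqP; rewrite eqn_leq min //= leqNgt; apply/negP => lmw.
by move: Hm; rewrite ltnNge (leq_trans (tri_mono lmw) le).
Qed.

Lemma diag_le z : tri (diag z) <= z < tri (diag z).+1.
Proof.
rewrite /diag; case: ex_minnP => -[|m] //= Hm min; rewrite Hm andbT.
by rewrite leqNgt; apply/negP => /min; rewrite ltnn.
Qed.

Lemma diag_cpair a b : diag (cpair a b) = a + b.
Proof. by apply: diagP; rewrite /cpair /=; lia. Qed.

Lemma csndE a b : csnd (cpair a b) = b.
Proof. by rewrite /csnd diag_cpair /cpair addKn. Qed.

Lemma cfstE a b : cfst (cpair a b) = a.
Proof. by rewrite /cfst csndE diag_cpair addnK. Qed.

Lemma cpairE z : cpair (cfst z) (csnd z) = z.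
Proof.
have /andP[le /= lt] := diag_le z.
have leS : csnd z <= diag z by rewrite /csnd; lia.
by rewrite /cpair /cfst subnK // /csnd subnKC.
Qed.

Lemma csnd_le z : csnd z <= z.
Proof. exact: leq_subr. Qed.

Definition cpair_code :=
  Comp add_code [:: Comp tri_code [:: add_code]; Proj 1].

Lemma computes_cpair a b : computes cpair_code [:: a; b] (cpair a b).
Proof.
apply: comp2; [exact: computes_add| |exact: computes_proj].
by apply: comp1; [exact: computes_tri|exact: computes_add].
Qed.

Definition diag_code := Mu (Comp sub_code
  [:: Comp Succ [:: Proj 1]; Comp tri_code [:: Comp Succ [:: Proj 0]]]).

Lemma computes_diag z : computes diag_code [:: z] (diag z).
Proof.
apply: (computes_mu (F := fun w => z.+1 - tri w.+1)) => [w||w].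
- apply: comp2; first exact: computes_sub.
    by apply: comp1; [exact: computes_succ|exact: computes_proj].
  apply: comp1; first exact: computes_tri.
  by apply: comp1; [exact: computes_succ|exact: computes_proj].
- by have /andP[_] := diag_le z; lia.
rewrite /diag; case: ex_minnP => m _ min lt.
by rewrite subn_gt0 ltnNge; apply/negP => /min; lia.
Qed.

Definition csnd_code :=
  Comp sub_code [:: Proj 0; Comp tri_code [:: diag_code]].

Lemma computes_csnd z : computes csnd_code [:: z] (csnd z).
Proof.
apply: comp2; [exact: computes_sub|exact: computes_proj|].
by apply: comp1; [exact: computes_tri|exact: computes_diag].
Qed.

Definition cfst_code := Comp sub_code [:: diag_code; csnd_code].

Lemma computes_cfst z : computes cfst_code [:: z] (cfst z).
Proof.
by apply: comp2; [exact: computes_sub|exact: computes_diag|exact: computes_csnd].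
Qed.

(** Codings are bijections with the natural numbers: an unbounded search for an
element of a type is then a search for a number, and [dec] is computed by the
identity. *)
Class coding (T : Type) := Coding {
  enc : T -> nat; dec : nat -> T; encK : cancel enc dec; decK : cancel dec enc }.

Lemma enc_inj T (cT : coding T) : injective (enc (T := T)).
Proof. exact: can_inj encK. Qed.

#[global] Instance coding_nat : coding nat :=
  {| enc := id; dec := id; encK := fun _ => erefl; decK := fun _ => erefl |}.

Section PairSeq.
Context {T U : Type} {cT : coding T} {cU : coding U}.

Definition enc_pair (p : T * U) := cpair (enc p.1) (enc p.2).
Definition dec_pair z : T * U := (dec (cfst z), dec (csnd z)).

Lemma enc_pairK : cancel enc_pair dec_pair.
Proof. by case=> a b; rewrite /dec_pair cfstE csndE !encK. Qed.

Lemma dec_pairK : cancel dec_pair enc_pair.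
Proof. by move=> z; rewrite /enc_pair !decK cpairE. Qed.

#[global] Instance coding_pair : coding (T * U) :=
  {| encK := enc_pairK; decK := dec_pairK |}.

Fixpoint enc_seq (l : seq T) :=
  if l is a :: l' then (cpair (enc a) (enc_seq l')).+1 else 0.

Fixpoint dec_seq_rec fuel z : seq T :=
  if fuel is f.+1 then
    if z is w.+1 then dec (cfst w) :: dec_seq_rec f (csnd w) else [::]
  else [::].

Definition dec_seq z := dec_seq_rec z z.

Lemma dec_seqK : cancel dec_seq enc_seq.
Proof.
move=> z; rewrite /dec_seq; have := leqnn z; move: {2 3}z => fuel.
elim: fuel z => [|f IH] [|w] //= le.
by rewrite decK IH ?cpairE //; apply: leq_trans (csnd_le w) le.
Qed.

Lemma enc_seq_inj : injective enc_seq.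
Proof.
elim=> [|a l IH] [|b l'] //= [E].
have Ea : enc a = enc b by rewrite -(cfstE (enc a) (enc_seq l)) E cfstE.
rewrite (enc_inj Ea).
by rewrite (IH l') //  -(csndE (enc a) (enc_seq l)) E csndE.
Qed.

#[global] Instance coding_seq : coding (seq T) :=
  {| encK := fun l => enc_seq_inj (dec_seqK (enc_seq l)); decK := dec_seqK |}.

End PairSeq.

(** * Total computable functions between coded types *)

(** Computability of a total function through the codings of its types. A function
of several arguments is treated as a function of nested pairs. *)
Definition cf {T U} {cT : coding T} {cU : coding U} (f : T -> U) :=
  exists c, forall x, computes c [:: enc x] (enc (f x)).

Notation cp P := (cf (fun t => nat_of_bool (P t))).

Section Closure.
Context {T U V W : Type} {cT : coding T} {cU : coding U} {cV : coding V}
  {cW : coding W}.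

Lemma cf_ext (f g : T -> U) : f =1 g -> cf f -> cf g.
Proof. by move=> E [c H]; exists c => x; rewrite -E. Qed.

Lemma cf_id : cf (fun t : T => t).
Proof. by exists (Proj 0). Qed.

Lemma cf_const (u : U) : cf (fun _ : T => u).
Proof. by exists (const_code (enc u)) => x; exact: computes_const. Qed.

Lemma cf_app (g : U -> V) (f : T -> U) : cf g -> cf f -> cf (fun t => g (f t)).
Proof.
move=> [d Hd] [c Hc]; exists (Comp d [:: c]) => x.
exact: comp1 (Hd _) (Hc x).
Qed.

Lemma cf_code2 (op : nat -> nat -> nat) c (f g : T -> nat) :
  (forall m n, computes c [:: m; n] (op m n)) -> cf f -> cf g ->
  cf (fun t => op (f t) (g t)).
Proof.
move=> H [a Ha] [b Hb]; exists (Comp c [:: a; b]) => x.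
exact: comp2 (H _ _) (Ha x) (Hb x).
Qed.

Lemma cf_pair (f : T -> U) (g : T -> V) : cf f -> cf g ->
  cf (fun t => (f t, g t)).
Proof.
move=> [a Ha] [b Hb]; exists (Comp cpair_code [:: a; b]) => x.
exact: comp2 (computes_cpair _ _) (Ha x) (Hb x).
Qed.

Lemma cf_app2 (g : U -> V -> W) (f : T -> U) (f' : T -> V) :
  cf (fun p => g p.1 p.2) -> cf f -> cf f' -> cf (fun t => g (f t) (f' t)).
Proof.
move=> [c Hc] [a Ha] [b Hb].
exists (Comp c [:: Comp cpair_code [:: a; b]]) => x.
exact: comp1 (Hc (f x, f' x)) (comp2 (computes_cpair _ _) (Ha x) (Hb x)).
Qed.

Lemma cf_fst (f : T -> U * V) : cf f -> cf (fun t => (f t).1).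
Proof.
move=> [a Ha]; exists (Comp cfst_code [:: a]) => x; apply: comp1 (Ha x).
by rewrite -[enc (f x).1](cfstE _ (enc (f x).2)); exact: computes_cfst.
Qed.

Lemma cf_snd (f : T -> U * V) : cf f -> cf (fun t => (f t).2).
Proof.
move=> [a Ha]; exists (Comp csnd_code [:: a]) => x; apply: comp1 (Ha x).
by rewrite -[enc (f x).2](csndE (enc (f x).1)); exact: computes_csnd.
Qed.

Lemma cf_dec (f : T -> nat) : cf f -> cf (fun t => dec (f t) : U).
Proof. by move=> [a Ha]; exists a => x; rewrite decK; exact: Ha. Qed.

Lemma cf_enc (f : T -> U) : cf f -> cf (fun t => enc (f t)).
Proof. by []. Qed.

Lemma cf_succ (f : T -> nat) : cf f -> cf (fun t => (f t).+1).
Proof.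
move=> [a Ha]; exists (Comp Succ [:: a]) => x.
exact: comp1 (computes_succ _ _) (Ha x).
Qed.

Lemma cf_pred (f : T -> nat) : cf f -> cf (fun t => (f t).-1).
Proof.
move=> [a Ha]; exists (Comp pred_code [:: a]) => x.
by apply: comp1 (Ha x); exact: computes_pred.
Qed.

Lemma cf_add (f g : T -> nat) : cf f -> cf g -> cf (fun t => f t + g t).
Proof. exact: cf_code2 computes_add. Qed.

Lemma cf_sub (f g : T -> nat) : cf f -> cf g -> cf (fun t => f t - g t).
Proof. exact: cf_code2 computes_sub. Qed.

(** Recursion with a parameter; all bounded quantifiers and list operations reduce
to it. *)
Lemma cf_rec (n : T -> nat) (f : T -> U) (g : T -> nat -> U -> U) :
  cf n -> cf f -> cf (fun p : T * (nat * U) => g p.1 p.2.1 p.2.2) ->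
  cf (fun t => nat_rect (fun=> U) (f t) (g t) (n t)).
Proof.
move=> [a Ha] [b Hb] [c Hc].
pose q := Comp cpair_code [:: Proj 2; Comp cpair_code [:: Proj 0; Proj 1]].
exists (Comp (Prec b (Comp c [:: q])) [:: a; Proj 0]) => x.
pose F k := @enc U cU (nat_rect (fun=> U) (f x) (g x) k).
apply: (comp2 _ (Ha x) (computes_proj 0 [:: enc x])).
apply: (@computes_prec b _ [:: enc x] F _ _ (n x)) => [|k]; first exact: Hb.
apply: (comp1 (Hc (x, (k, nat_rect (fun=> U) (f x) (g x) k)))).
apply: comp2; [exact: computes_cpair|exact: computes_proj|].
by apply: comp2; [exact: computes_cpair|exact: computes_proj|exact: computes_proj].
Qed.

End Closure.

Section Branching.
Context {T U : Type} {cT : coding T} {cU : coding U}.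

Lemma cf_if (b : T -> bool) (f g : T -> U) : cp b -> cf f -> cf g ->
  cf (fun t => if b t then f t else g t).
Proof.
move=> Hb Hf Hg; apply: (cf_ext (f := fun t =>
  nat_rect (fun=> U) (g t) (fun _ _ => f t) (b t))) => [t|]; first by case: (b t).
by apply: cf_rec => //=; apply: (cf_app Hf); apply: cf_fst; exact: cf_id.
Qed.

(** Search is total only because a witness always exists; the proof of existence
does not enter the program. *)
Lemma cf_min (P : T -> nat -> bool) (ex : forall t, exists n, P t n) :
  cp (fun p : T * nat => P p.1 p.2) -> cf (fun t => ex_minn (ex t)).
Proof.
move=> [c Hc].
exists (Mu (Comp sub_code [:: const_code 1;
  Comp c [:: Comp cpair_code [:: Proj 1; Proj 0]]])) => x.
case: ex_minnP => m Pm min.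
apply: (computes_mu (F := fun k => 1 - P x k)) => [y||z lt].
- apply: comp2; [exact: computes_sub|exact: computes_const|].
  apply: (comp1 (Hc (x, y))).
  by apply: comp2; [exact: computes_cpair|exact: computes_proj|exact: computes_proj].
- by rewrite Pm.
by case Pz : (P x z) => //; move: (min _ Pz); rewrite leqNgt lt.
Qed.

End Branching.

Section Predicates.
Context {T : Type} {cT : coding T}.

Lemma cp_neg (P : T -> bool) : cp P -> cp (fun t => ~~ P t).
Proof.
move=> HP; apply: (cf_ext (f := fun t => 1 - P t)) => [t|]; first by case: (P t).
by apply: cf_sub => //; exact: cf_const.
Qed.

Lemma cp_if (P Q R : T -> bool) : cp P -> cp Q -> cp R ->
  cp (fun t => if P t then Q t else R t).
Proof.
move=> HP HQ HR; apply: (cf_ext (f := fun t =>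
  if P t then nat_of_bool (Q t) else R t)) => [t|]; first by case: (P t).
exact: cf_if.
Qed.

Lemma cp_and (P Q : T -> bool) : cp P -> cp Q -> cp (fun t => P t && Q t).
Proof. by move=> HP HQ; apply: cp_if => //; exact: cf_const. Qed.

Lemma cp_or (P Q : T -> bool) : cp P -> cp Q -> cp (fun t => P t || Q t).
Proof. by move=> HP HQ; apply: cp_if => //; exact: cf_const. Qed.

Lemma cp_imp (P Q : T -> bool) : cp P -> cp Q -> cp (fun t => P t ==> Q t).
Proof. by move=> HP HQ; apply: cp_if => //; exact: cf_const. Qed.

Lemma cp_eq0 (f : T -> nat) : cf f -> cp (fun t => f t == 0).
Proof.
move=> Hf; apply: (cf_ext (f := fun t => 1 - f t)) => [t|]; first by case: (f t).
by apply: cf_sub => //; exact: cf_const.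
Qed.

Lemma cp_leq (f g : T -> nat) : cf f -> cf g -> cp (fun t => f t <= g t).
Proof. by move=> Hf Hg; apply: cp_eq0; exact: cf_sub. Qed.

Lemma cp_eqn (f g : T -> nat) : cf f -> cf g -> cp (fun t => f t == g t).
Proof.
move=> Hf Hg; apply: (cf_ext (f := fun t => nat_of_bool ((f t <= g t) && (g t <= f t)))).
  by move=> t; rewrite eqn_leq.
by apply: cp_and; exact: cp_leq.
Qed.

Lemma cp_eqb (P Q : T -> bool) : cp P -> cp Q -> cp (fun t => P t == Q t).
Proof.
move=> HP HQ; apply: (cf_ext (f := fun t => nat_of_bool ((P t : nat) == Q t))) => [t|].
  by case: (P t) (Q t) => -[].
exact: cp_eqn.
Qed.

End Predicates.

Section BoundedQuantifiers.
Context {T : Type} {cT : coding T}.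

Lemma cp_has_iota (n : T -> nat) (P : T -> nat -> bool) : cf n ->
  cp (fun p : T * nat => P p.1 p.2) -> cp (fun t => has (P t) (iota 0 (n t))).
Proof.
move=> Hn HP; apply: (cf_ext (f := fun t => nat_rect (fun=> nat) 0
  (fun k v => if P t k then 1 else v) (n t))) => [t|].
  elim: (n t) => // k IH.
  have -> : iota 0 k.+1 = rcons (iota 0 k) k by rewrite -addn1 iotaD cats1.
  by rewrite has_rcons /= IH; case: (P t k).
apply: cf_rec => //; first exact: cf_const.
apply: cf_if; [|exact: cf_const|by do 2!apply: cf_snd; exact: cf_id].
apply: (cf_app HP (f := fun p : T * (nat * nat) => (p.1, p.2.1))).
by apply: cf_pair; [|apply: cf_fst; apply: cf_snd]; try apply: cf_fst; exact: cf_id.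
Qed.

Lemma cp_all_iota (n : T -> nat) (P : T -> nat -> bool) : cf n ->
  cp (fun p : T * nat => P p.1 p.2) -> cp (fun t => all (P t) (iota 0 (n t))).
Proof.
move=> Hn HP; apply: (cf_ext (f := fun t =>
  nat_of_bool (~~ has (fun k => ~~ P t k) (iota 0 (n t))))) => [t|].
  by rewrite has_predC negbK.
by apply: cp_neg; apply: cp_has_iota => //; exact: cp_neg.
Qed.

End BoundedQuantifiers.

Section SeqOperations.
Context {T U : Type} {cT : coding T} {cU : coding U}.

Lemma cf_cons (f : T -> U) (l : T -> seq U) : cf f -> cf l ->
  cf (fun t => f t :: l t).
Proof. by move=> Hf Hl; case: (cf_succ (cf_enc (cf_pair Hf Hl))) => c; exists c. Qed.

Lemma cf_behead (l : T -> seq U) : cf l -> cf (fun t => behead (l t)).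
Proof.
move=> Hl; have [c Hc] : cf (fun t => csnd (enc (l t)).-1).
  apply: (cf_app (g := csnd)); first by exists csnd_code => x; exact: computes_csnd.
  by apply: cf_pred; exact: cf_enc.
exists c => x; move: (Hc x); case: (l x) => [|a l'] /=; last by rewrite csndE.
by have -> : csnd 0 = 0 by apply/eqP; rewrite -leqn0; exact: csnd_le.
Qed.

Lemma cf_head (l : T -> seq U) : cf l -> cf (fun t => head (dec 0) (l t)).
Proof.
move=> Hl; have [c Hc] : cf (fun t => cfst (enc (l t)).-1).
  apply: (cf_app (g := cfst)); first by exists cfst_code => x; exact: computes_cfst.
  by apply: cf_pred; exact: cf_enc.
exists c => x; move: (Hc x); case: (l x) => [|a l'] /=; last by rewrite cfstE.
rewrite decK; have -> // : cfst 0 = 0.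
by rewrite /cfst /csnd sub0n subn0; apply: diagP.
Qed.

End SeqOperations.

Section Lists.
Context {T U : Type} {cT : coding T} {cU : coding U}.

(** Lists are traversed by indices: iterating [behead] gives [nth], and with it
quantifiers over lists become bounded quantifiers over numbers. *)
Lemma cf_drop (n : T -> nat) (l : T -> seq U) : cf n -> cf l ->
  cf (fun t => drop (n t) (l t)).
Proof.
move=> Hn Hl; apply: (cf_ext (f := fun t =>
  nat_rect (fun=> seq U) (l t) (fun _ r => behead r) (n t))) => [t|].
  elim: (n t) => [|k IH]; first by rewrite drop0.
  by rewrite -[k.+1]add1n -drop_drop drop1 -IH.
by apply: cf_rec => //; apply: cf_behead; do 2!apply: cf_snd; exact: cf_id.
Qed.

Lemma cf_nth (l : T -> seq U) (n : T -> nat) : cf l -> cf n ->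
  cf (fun t => nth (dec 0) (l t) (n t)).
Proof.
move=> Hl Hn; apply: (cf_ext (f := fun t => head (dec 0) (drop (n t) (l t)))).
  by move=> t; rewrite -nth0 nth_drop addn0.
by apply: cf_head; exact: cf_drop.
Qed.

End Lists.

Section ListQuantifiers.
Context {T U : Type} {cT : coding T} {cU : coding U}.

Lemma size_ex (l : seq U) : exists n, enc (drop n l) == 0.
Proof. by exists (size l); rewrite drop_size. Qed.

Lemma cf_size (l : T -> seq U) : cf l -> cf (fun t => size (l t)).
Proof.
move=> Hl; apply: (cf_ext (f := fun t => ex_minn (size_ex (l t)))) => [t|].
  case: ex_minnP => m Hm min; apply/eqP; rewrite eqn_leq min ?drop_size //=.
  have : size (drop m (l t)) = 0 by case: (drop m (l t)) Hm.
  by move/eqP; rewrite size_drop subn_eq0.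
apply: cf_min; apply: cp_eq0; apply: cf_enc; apply: cf_drop.
  by apply: cf_snd; exact: cf_id.
by apply: (cf_app Hl); apply: cf_fst; exact: cf_id.
Qed.

Lemma cp_has (l : T -> seq U) (P : T -> U -> bool) : cf l ->
  cp (fun p : T * U => P p.1 p.2) -> cp (fun t => has (P t) (l t)).
Proof.
move=> Hl HP; apply: (cf_ext (f := fun t =>
  nat_of_bool (has (fun i => P t (nth (dec 0) (l t) i)) (iota 0 (size (l t)))))) => [t|].
  by rewrite -[in RHS](mkseq_nth (dec 0) (l t)) has_map.
apply: cp_has_iota; first exact: cf_size.
apply: (cf_app HP (f := fun p : T * nat => (p.1, nth (dec 0) (l p.1) p.2))).
apply: cf_pair; first by apply: cf_fst; exact: cf_id.
apply: cf_nth; last by apply: cf_snd; exact: cf_id.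
by apply: (cf_app Hl); apply: cf_fst; exact: cf_id.
Qed.

Lemma cp_all (l : T -> seq U) (P : T -> U -> bool) : cf l ->
  cp (fun p : T * U => P p.1 p.2) -> cp (fun t => all (P t) (l t)).
Proof.
move=> Hl HP; apply: (cf_ext (f := fun t =>
  nat_of_bool (~~ has (fun k => ~~ P t k) (l t)))).
  by move=> t; rewrite has_predC negbK.
by apply: cp_neg; apply: cp_has => //; exact: cp_neg.
Qed.

End ListQuantifiers.

Section Equality.
Context {T : Type} {U : eqType} {cT : coding T} {cU : coding U}.

Lemma cp_eq (f g : T -> U) : cf f -> cf g -> cp (fun t => f t == g t).
Proof.
move=> Hf Hg; apply: (cf_ext (f := fun t =>
  nat_of_bool (enc (f t) == enc (g t)))) => [t|].
  by rewrite (inj_eq (@enc_inj _ _)).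
by apply: cp_eqn; exact: cf_enc.
Qed.

End Equality.

Section Membership.
Context {T : Type} {U : eqType} {cT : coding T} {cU : coding U}.

Lemma cp_mem (f : T -> U) (l : T -> seq U) : cf f -> cf l ->
  cp (fun t => f t \in l t).
Proof.
move=> Hf Hl; apply: (cf_ext (f := fun t => nat_of_bool (has (fun u => f t == u) (l t)))).
  move=> t; rewrite -has_pred1; congr nat_of_bool.
  by apply: eq_has => u /=; rewrite eq_sym.
apply: (cp_has (P := fun t u => f t == u)) => //.
apply: cp_eq; last by apply: cf_snd; exact: cf_id.
by apply: (cf_app Hf); apply: cf_fst; exact: cf_id.
Qed.

End Membership.

(** Extension point of [cf_auto] for operations that are introduced later. *)
Ltac cf_hook := fail.

(** Proves computability by following the syntax of the function body. The bound
variable is the nested pair of all parameters, and the variable of an inner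
quantifier becomes its last component. *)
Ltac cf_auto := cbv beta; first
 [ assumption
 | match goal with
   | H : cf (fun x => nat_of_bool (x \in dom ?B))
     |- cf (fun t => nat_of_bool (in_mem (@?f t) (mem (dom ?B)))) =>
       refine (cf_app (g := fun x => nat_of_bool (x \in dom B)) (f := f) H _);
       cf_auto
   | H : cf (fun u => nat_of_bool (erel ?B u.1 u.2))
     |- cf (fun t => nat_of_bool (erel ?B (@?f t) (@?g t))) =>
       refine (cf_app2 (g := fun a b => nat_of_bool (erel B a b))
         (f := f) (f' := g) H _ _); cf_auto
   | H : cf ?F |- cf (fun t => ?F (@?f t)) =>
       refine (cf_app (g := F) (f := f) H _); cf_auto
   | H : cf (fun x => nat_of_bool (?P x))
     |- cf (fun t => nat_of_bool (?P (@?f t))) =>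
       refine (cf_app (g := fun x => nat_of_bool (P x)) (f := f) H _); cf_auto
   end
 | cf_hook
 | exact (cf_const _)
 | lazymatch goal with
   | |- cf (fun t => t) => exact cf_id
   | |- cf fst => exact (cf_fst cf_id)
   | |- cf snd => exact (cf_snd cf_id)
   | |- cf (fun t => fst (@?f t)) => refine (cf_fst (f := f) _); cf_auto
   | |- cf (fun t => snd (@?f t)) => refine (cf_snd (f := f) _); cf_auto
   | |- cf (fun t => (@?f t, @?g t)) =>
       refine (cf_pair (f := f) (g := g) _ _); cf_auto
   | |- cf (fun t => enc (@?f t)) => refine (cf_enc (f := f) _); cf_auto
   | |- cf (fun t => dec (@?f t)) => refine (cf_dec (f := f) _); cf_auto
   | |- cf (fun t => S (@?f t)) => refine (cf_succ (f := f) _); cf_auto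
   | |- cf (fun t => predn (@?f t)) => refine (cf_pred (f := f) _); cf_auto
   | |- cf (fun t => addn (@?f t) (@?g t)) =>
       refine (cf_add (f := f) (g := g) _ _); cf_auto
   | |- cf (fun t => cons (@?f t) (@?g t)) =>
       refine (cf_cons (f := f) (l := g) _ _); cf_auto
   | |- cf (fun t => behead (@?f t)) => refine (cf_behead (l := f) _); cf_auto
   | |- cf (fun t => head _ (@?f t)) => refine (cf_head (l := f) _); cf_auto
   | |- cf (fun t => nth _ (@?l t) (@?n t)) =>
       refine (cf_nth (l := l) (n := n) _ _); cf_auto
   | |- cf (fun t => size (@?l t)) => refine (cf_size (l := l) _); cf_auto
   | |- cf (fun t => nat_of_bool (@?P t && @?Q t)) =>
       refine (cp_and (P := P) (Q := Q) _ _); cf_auto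
   | |- cf (fun t => nat_of_bool (@?P t || @?Q t)) =>
       refine (cp_or (P := P) (Q := Q) _ _); cf_auto
   | |- cf (fun t => nat_of_bool (@?P t ==> @?Q t)) =>
       refine (cp_imp (P := P) (Q := Q) _ _); cf_auto
   | |- cf (fun t => nat_of_bool (~~ @?P t)) => refine (cp_neg (P := P) _); cf_auto
   | |- cf (fun t => nat_of_bool (@eq_op _ (@?f t) (@?g t))) =>
       first [ refine (cp_eqb (P := f) (Q := g) _ _)
             | refine (cp_eq (f := f) (g := g) _ _) ]; cf_auto
   | |- cf (fun t => nat_of_bool (leq (@?f t) (@?g t))) =>
       refine (cp_leq (f := f) (g := g) _ _); cf_auto
   | |- cf (fun t => nat_of_bool (in_mem (@?f t) (@mem _ (seq_predType _) (@?l t)))) =>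
       refine (cp_mem (f := f) (l := l) _ _); cf_auto
   | |- cf (fun t => nat_of_bool (has (@?P t) (iota 0 (@?n t)))) =>
       refine (cp_has_iota (n := n) (P := P) _ _); cf_auto
   | |- cf (fun t => nat_of_bool (all (@?P t) (iota 0 (@?n t)))) =>
       refine (cp_all_iota (n := n) (P := P) _ _); cf_auto
   | |- cf (fun t => nat_of_bool (has (@?P t) (@?l t))) =>
       refine (cp_has (l := l) (P := P) _ _); cf_auto
   | |- cf (fun t => nat_of_bool (all (@?P t) (@?l t))) =>
       refine (cp_all (l := l) (P := P) _ _); cf_auto
   end
 | idtac ].

Lemma cf_count T U (cT : coding T) (cU : coding U) (l : T -> seq U)
    (P : T -> U -> bool) : cf l -> cp (fun p : T * U => P p.1 p.2) ->
  cf (fun t => count (P t) (l t)).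
Proof.
move=> Hl HP; apply: (cf_ext (f := fun t => nat_rect (fun=> nat) 0
  (fun k v => P t (nth (dec 0) (l t) k) + v) (size (l t)))) => [t|].
  rewrite -[in RHS](take_size (l t)).
  have : size (l t) <= size (l t) by [].
  move: {1 3 4}(size (l t)) => k; elim: k => [|k IH] lt; first by rewrite take0.
  by rewrite (take_nth (dec 0)) // -cats1 count_cat /= addn0 addnC IH // ltnW.
apply: cf_rec; first exact: cf_size.
  exact: cf_const.
apply: cf_add; last by cf_auto.
apply: (cf_app HP (f := fun p => (p.1, nth (dec 0) (l p.1) p.2.1))).
by cf_auto.
Qed.

Lemma cp_pairwise T U (cT : coding T) (cU : coding U) (l : T -> seq U)
    (r : T -> U -> U -> bool) : cf l ->
  cp (fun p : T * (U * U) => r p.1 p.2.1 p.2.2) ->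
  cp (fun t => pairwise (r t) (l t)).
Proof.
move=> Hl Hr; apply: (cf_ext (f := fun t => nat_of_bool (all (fun j =>
  all (fun i => r t (nth (dec 0) (l t) i) (nth (dec 0) (l t) j)) (iota 0 j))
  (iota 0 (size (l t)))))) => [t|].
  congr nat_of_bool; apply/allP/(pairwiseP (dec 0)) => [H i j _ ltj ltij|H j].
    have Hj : j \in iota 0 (size (l t)) by rewrite mem_iota.
    by apply: (allP (H j Hj)); rewrite mem_iota.
  rewrite mem_iota /= => ltj; apply/allP => i; rewrite mem_iota /= => lti.
  by apply: H => //; rewrite inE; lia.
apply: (cp_all_iota (P := fun t j => all (fun i =>
  r t (nth (dec 0) (l t) i) (nth (dec 0) (l t) j)) (iota 0 j))).
  by cf_auto.
apply: (cp_all_iota (P := fun (p : T * nat) i =>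
  r p.1 (nth (dec 0) (l p.1) i) (nth (dec 0) (l p.1) p.2))).
  by cf_auto.
apply: (cf_app Hr (f := fun p : T * nat * nat =>
  (p.1.1, (nth (dec 0) (l p.1.1) p.2, nth (dec 0) (l p.1.1) p.1.2)))).
by cf_auto.
Qed.

Lemma cf_iota T (cT : coding T) (n : T -> nat) : cf n ->
  cf (fun t => iota 0 (n t)).
Proof.
move=> Hn; apply: (cf_ext (f := fun t => nat_rect (fun=> seq nat) [::]
  (fun k v => (n t - k.+1) :: v) (n t))) => [t|].
  have E k : k <= n t -> nat_rect (fun=> seq nat) [::]
      (fun k v => (n t - k.+1) :: v) k = iota (n t - k) k.
    elim: k => // k IH lt; rewrite [LHS]/= IH ?(ltnW lt) //=.
    by congr (_ :: iota _ _); lia.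
  by rewrite E // subnn.
apply: cf_rec => //; first exact: cf_const.
apply: cf_cons; last by cf_auto.
by apply: cf_sub; [apply: (cf_app Hn)|]; cf_auto.
Qed.

(** Effective dependent choice. The successor of [x] is the first [y] that satisfies
the relation, so the sequence is computable when the invariant and the relation
are; guarding the search by the invariant makes it total. *)
Lemma cf_search (T : Type) (cT : coding T) (I : T -> bool)
    (R : nat -> T -> T -> bool) (x0 : T) : I x0 ->
  (forall n x, I x -> exists y, I y && R n x y) ->
  exists F : nat -> T, [/\ F 0 = x0, forall n, I (F n),
    forall n, R n (F n) (F n.+1) &
    cp I -> cp (fun p : nat * (T * T) => R p.1 p.2.1 p.2.2) -> cf F].
Proof.
move=> I0 H.
have ex (p : nat * T) : exists k, I p.2 ==> (I (dec k) && R p.1 p.2 (dec k)).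
  case Ip : (I p.2); last by exists 0.
  by have [y Hy] := H p.1 _ Ip; exists (enc y); rewrite encK.
pose step n x : T := @dec T cT (ex_minn (ex (n, x))).
have stepP n x : I x -> I (step n x) && R n x (step n x).
  by rewrite /step; case: ex_minnP => k + _ Ix; rewrite /= Ix.
pose F n := nat_rect (fun=> T) x0 step n.
have IF n : I (F n) by elim: n => //= n /(stepP n) /andP[].
exists F; split=> // [n|HI HR]; first by have /andP[] := stepP n _ (IF n).
apply: (cf_rec (n := id) (f := fun=> x0) (g := fun=> step)).
- exact: cf_id.
- exact: cf_const.
rewrite /step; apply: (cf_app (g := fun p => dec (ex_minn (ex p)))
  (f := fun p : nat * (nat * T) => (p.2.1, p.2.2))); last by cf_auto.
apply: cf_dec; apply: cf_min.
apply: (cp_imp (P := fun p : nat * T * nat => I p.1.2)).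
  by apply: (cf_app HI); cf_auto.
apply: (cp_and (P := fun p : nat * T * nat => I (dec p.2))
  (Q := fun p : nat * T * nat => R p.1.1 p.1.2 (dec p.2))).
  by apply: (cf_app HI); cf_auto.
by apply: (cf_app HR (f := fun p => (p.1.1, (p.1.2, dec p.2)))); cf_auto.
Qed.

(** * A stagewise enumeration of all computations *)

Fixpoint ecode (c : code) : nat :=
  match c with
  | Zero => enc (0, 0)
  | Succ => enc (1, 0)
  | Proj i => enc (2, i)
  | Comp f gs => enc (3, enc (ecode f, enc (map ecode gs)))
  | Prec f g => enc (4, enc (ecode f, ecode g))
  | Mu f => enc (5, ecode f)
  end.

Notation fact := (nat * (seq nat * nat))%type.

(** One step of a derivation: the value claimed by the fact [t], a triple of a coded
program, its arguments and its value, follows from facts in [D] by one clause of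
[eval]. The intermediate values that [Comp], [Prec] and [Mu] need are looked up
in [D], so no search is involved. *)
Definition justified (D : seq fact) (t : fact) : bool :=
  let tag := (dec t.1 : nat * nat).1 in
  let arg := (dec t.1 : nat * nat).2 in
  let fg := dec arg : nat * nat in
  let gs := dec fg.2 : seq nat in
  let xs := t.2.1 in
  let y := t.2.2 in
  [|| (tag == 0) && (y == 0),
      (tag == 1) && (y == (head (dec 0) xs).+1),
      (tag == 2) && (y == nth (dec 0) xs arg),
      (tag == 3) && has (fun u : fact => [&& u.1 == fg.1, u.2.2 == y,
         size gs == size u.2.1 & all (fun k =>
           (nth (dec 0) gs k, (xs, nth (dec 0) u.2.1 k)) \in D)
           (iota 0 (size gs))]) D,
      [&& tag == 4, head (dec 0) xs == 0 & (fg.1, (behead xs, y)) \in D],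
      [&& tag == 4, head (dec 0) xs != 0 & has (fun u : fact =>
         [&& u.1 == t.1, u.2.1 == (head (dec 0) xs).-1 :: behead xs &
          (fg.2, ([:: (head (dec 0) xs).-1, u.2.2 & behead xs], y)) \in D]) D]
    | [&& tag == 5, (arg, (y :: xs, 0)) \in D & all (fun z =>
         has (fun u : fact =>
           [&& u.1 == arg, u.2.1 == z :: xs & u.2.2 != 0]) D) (iota 0 y)]].

Definition facts_step s (D : seq fact) : seq fact :=
  let t := dec (dec s : nat * nat).1 : fact in
  if justified D t then t :: D else D.

(** Stage [s] proposes the first component of the pair coded by [s], so that every
fact is proposed at arbitrarily late stages. *)
Definition facts s : seq fact := nat_rect (fun=> seq fact) [::] facts_step s.

(** The program with code [e] is seen at stage [s] to have value [a] at [x]. *)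
Definition conv s e x a := (e, ([:: x], a)) \in facts s.

Lemma cf_facts : cf facts.
Proof.
apply: (cf_rec (n := id) (f := fun=> [::]) (g := fun=> facts_step)).
- exact: cf_id.
- exact: cf_const.
rewrite /facts_step /justified; by apply: cf_if; cf_auto.
Qed.

Lemma facts_sub s t : s <= t -> {subset facts s <= facts t}.
Proof.
move=> le; rewrite -(subnK le); elim: (t - s) => //= k IH u /IH.
by rewrite /facts_step; case: ifP => // _ H; rewrite inE H orbT.
Qed.

Lemma conv_mono s t e x a : s <= t -> conv s e x a -> conv t e x a.
Proof. by move/facts_sub; apply. Qed.

Arguments enc : simpl never.
Arguments dec : simpl never.

Lemma justifiedE D c xs y : justified D (ecode c, (xs, y)) =
  match c with
  | Zero => y == 0
  | Succ => y == (head 0 xs).+1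
  | Proj i => y == nth 0 xs i
  | Comp f gs => has (fun u : fact => [&& u.1 == ecode f, u.2.2 == y,
      size gs == size u.2.1 & all (fun k =>
        (ecode (nth Zero gs k), (xs, nth 0 u.2.1 k)) \in D)
        (iota 0 (size gs))]) D
  | Prec f g =>
      if head 0 xs is n.+1 then has (fun u : fact =>
        [&& u.1 == ecode (Prec f g), u.2.1 == n :: behead xs &
          (ecode g, ([:: n, u.2.2 & behead xs], y)) \in D]) D
      else (ecode f, (behead xs, y)) \in D
  | Mu f => ((ecode f, (y :: xs, 0)) \in D) && all (fun z =>
      has (fun u : fact =>
        [&& u.1 == ecode f, u.2.1 == z :: xs & u.2.2 != 0]) D) (iota 0 y)
  end.
Proof.
have tagE tag arg f g gs : dec arg = (f, g) -> dec g = gs ->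
  justified D (enc (tag, arg), (xs, y)) =
  [|| (tag == 0) && (y == 0),
      (tag == 1) && (y == (head 0 xs).+1),
      (tag == 2) && (y == nth 0 xs arg),
      (tag == 3) && has (fun u : fact => [&& u.1 == f, u.2.2 == y,
         size gs == size u.2.1 & all (fun k =>
           (nth 0 gs k, (xs, nth 0 u.2.1 k)) \in D)
           (iota 0 (size gs))]) D,
      [&& tag == 4, head 0 xs == 0 & (f, (behead xs, y)) \in D],
      [&& tag == 4, head 0 xs != 0 & has (fun u : fact =>
         [&& u.1 == enc (tag, arg), u.2.1 == (head 0 xs).-1 :: behead xs &
          (g, ([:: (head 0 xs).-1, u.2.2 & behead xs], y)) \in D]) D]
    | [&& tag == 5, (arg, (y :: xs, 0)) \in D & all (fun z =>
         has (fun u : fact =>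
           [&& u.1 == arg, u.2.1 == z :: xs & u.2.2 != 0]) D) (iota 0 y)]].
  by rewrite /justified encK => -> /= ->.
case: c => [||i|f gs|f g|f].
- by rewrite [LHS](tagE _ _ _ _ _ (surjective_pairing _) erefl) /= orbF.
- by rewrite [LHS](tagE _ _ _ _ _ (surjective_pairing _) erefl) /= orbF.
- by rewrite [LHS](tagE _ _ _ _ _ (surjective_pairing _) erefl) /= orbF.
- rewrite [LHS](tagE _ _ _ _ _ (encK _) (encK _)) /= orbF.
  apply: eq_has => u; do 2!congr (_ && _); rewrite size_map.
  congr (_ && _); apply: eq_in_all => k; rewrite mem_iota /= => lt.
  by rewrite (nth_map Zero).
- rewrite [LHS](tagE _ _ _ _ _ (encK _) erefl) /= orbF.
  by case: (head 0 xs) => [|n]; rewrite /= ?orbF.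
by rewrite [LHS](tagE _ _ _ _ _ (surjective_pairing _) erefl).
Qed.

Lemma facts_sound s c xs y : (ecode c, (xs, y)) \in facts s -> eval c xs y.
Proof.
elim: s c xs y => // s IH c xs y.
rewrite /= {1}/facts_step; set D := facts s in IH *.
case: ifP => [|_]; last exact: IH.
set t := dec _ => J; rewrite inE => /orP[/eqP tE|]; last exact: IH.
move: J; rewrite -tE justifiedE => {tE t}.
case: c => [||i|f gs|f g|f].
- by move/eqP.
- by move/eqP.
- by move/eqP.
- case/hasP=> -[k [ys z]] /= inD /and4P[/eqP ek /eqP ez /eqP sz /allP H].
  rewrite {}ek {}ez in inD.
  apply/eval_comp; exists ys; last exact: IH.
  by split=> // k' lt; apply: IH; apply: H; rewrite mem_iota.
- rewrite /=; case: (head 0 xs) => [|n]; first exact: IH.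
  case/hasP=> -[k [ys z]] /= inD /and3P[/eqP ek /eqP ez /IH H].
  exists z => //; rewrite {}ek {}ez in inD.
  exact: (IH (Prec f g) (n :: behead xs) z inD).
case/andP=> /IH H0 /allP H; split=> // z lt.
have /hasP[[k [ys v]] inD /and3P[/= /eqP ek /eqP ez]] :
    has (fun u : fact => [&& u.1 == ecode f, u.2.1 == z :: xs & u.2.2 != 0]) D.
  by apply: H; rewrite mem_iota.
rewrite {}ek {}ez in inD; case: v inD => // v /IH Hv _.
by exists v.
Qed.

(** Finitely many events, each of which lasts once it has happened, have all
happened at some common stage. *)
Lemma bounded_stage (Q : nat -> nat -> Prop) n :
  (forall k s t, s <= t -> Q s k -> Q t k) ->
  (forall k, k < n -> exists s, Q s k) -> exists s, forall k, k < n -> Q s k.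
Proof.
move=> mono; elim: n => [|n IH] H; first by exists 0.
have [s Hs] := IH (fun k lt => H k (ltnW lt)).
have [t Ht] := H n (ltnSn n).
exists (maxn s t) => k; rewrite ltnS leq_eqVlt => /orP[/eqP->|lt].
  by apply: mono Ht; exact: leq_maxr.
by apply: mono (Hs _ lt); exact: leq_maxl.
Qed.

Lemma facts_add s (q : fact) : (forall t, s <= t -> justified (facts t) q) ->
  exists t, q \in facts t.
Proof.
move=> H; exists (cpair (enc q) s).+1; rewrite /= {1}/facts_step.
have -> : dec (dec (cpair (enc q) s) : nat * nat).1 = q.
  have -> : cpair (enc q) s = enc (enc q, s) by [].
  by rewrite (encK (enc q, s)) /= encK.
rewrite H ?inE ?eqxx //; apply: leq_addl.
Qed.

(** The induction principle generated for [code] has no hypothesis on the list of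
programs inside [Comp]. *)
Lemma code_nested_ind (P : code -> Prop) : P Zero -> P Succ ->
  (forall i, P (Proj i)) ->
  (forall f gs, P f -> (forall k, k < size gs -> P (nth Zero gs k)) ->
     P (Comp f gs)) ->
  (forall f g, P f -> P g -> P (Prec f g)) ->
  (forall f, P f -> P (Mu f)) -> forall c, P c.
Proof.
move=> H0 H1 H2 H3 H4 H5; fix IH 1; case=> [||i|f gs|f g|f].
- exact: H0.
- exact: H1.
- exact: H2.
- apply: H3; first exact: IH.
  elim: gs => [|g gs IHgs] [|k] lt; [exact: H0|exact: H0|exact: IH|].
  exact: IHgs.
- by apply: H4; exact: IH.
by apply: H5; exact: IH.
Qed.

Lemma facts_complete c xs y : eval c xs y ->
  exists s, (ecode c, (xs, y)) \in facts s.
Proof.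
elim/code_nested_ind: c xs y => [||i|f gs IHf IHgs|f g IHf IHg|f IHf] xs y.
- by move/eqP=> H; apply: (@facts_add 0) => t _; rewrite justifiedE.
- by move/eqP=> H; apply: (@facts_add 0) => t _; rewrite justifiedE.
- by move/eqP=> H; apply: (@facts_add 0) => t _; rewrite justifiedE.
- case/eval_comp=> ys [sz Hg] /IHf[s1 H1].
  have [|s2 H2] := @bounded_stage (fun s k =>
    (ecode (nth Zero gs k), (xs, nth 0 ys k)) \in facts s) (size gs) _
    (fun k lt => IHgs k lt _ _ (Hg k lt)).
    by move=> k s t le; exact: facts_sub.
  apply: (@facts_add (maxn s1 s2)) => t; rewrite geq_max => /andP[le1 le2].
  rewrite justifiedE; apply/hasP; exists (ecode f, (ys, y)).
    exact: facts_sub H1.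
  rewrite /= !eqxx sz eqxx /= -sz; apply/allP => k; rewrite mem_iota /= => lt.
  exact: facts_sub (H2 _ lt).
- case: xs => [|n xs].
    case/IHf=> s Hs; apply: (@facts_add s) => t le; rewrite justifiedE /=.
    exact: facts_sub Hs.
  elim: n y => [|n IHn] y.
    case/IHf=> s Hs; apply: (@facts_add s) => t le; rewrite justifiedE /=.
    exact: facts_sub Hs.
  case=> v /IHn[s1 H1] /IHg[s2 H2].
  apply: (@facts_add (maxn s1 s2)) => t; rewrite geq_max => /andP[le1 le2].
  rewrite justifiedE; apply/hasP; exists (ecode (Prec f g), ([:: n & xs], v)).
    exact: facts_sub H1.
  rewrite !eqxx /=; exact: facts_sub H2.
case=> /IHf[s1 H1] Hlt.
have [|z lt|s2 H2] := @bounded_stage (fun s z =>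
  exists v, (ecode f, (z :: xs, v.+1)) \in facts s) y.
- by move=> k s t le [v Hv]; exists v; exact: facts_sub Hv.
- by have [v /IHf[s Hs]] := Hlt z lt; exists s, v.
apply: (@facts_add (maxn s1 s2)) => t; rewrite geq_max => /andP[le1 le2].
rewrite justifiedE (facts_sub le1 H1) /=; apply/allP => z; rewrite mem_iota /= => lt.
have [v Hv] := H2 _ lt; apply/hasP; exists (ecode f, (z :: xs, v.+1)).
  exact: facts_sub Hv.
by rewrite /= !eqxx.
Qed.

Lemma conv_computes c x a : computes c [:: x] a ->
  (exists s, conv s (ecode c) x a) /\
  (forall s b, conv s (ecode c) x b -> b = a).
Proof.
move=> H; split; first by apply: facts_complete; apply/H.
by move=> s b /facts_sound/H.
Qed.

Lemma cp_conv T (cT : coding T) (s e x a : T -> nat) :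
  cf s -> cf e -> cf x -> cf a -> cp (fun t => conv (s t) (e t) (x t) (a t)).
Proof.
move=> Hs He Hx Ha; rewrite /conv.
apply: (cp_mem (f := fun t => (e t, ([:: x t], a t))) (l := fun t => facts (s t))).
  by apply: cf_pair => //; apply: cf_pair => //; apply: cf_cons => //; exact: cf_const.
exact: (cf_app cf_facts).
Qed.

Ltac cf_hook ::= lazymatch goal with
  | |- cf (fun t => iota 0 (@?n t)) => refine (cf_iota (n := n) _); cf_auto
  | |- cf (fun t => nat_of_bool (pairwise (@?r t) (@?l t))) =>
      refine (cp_pairwise (r := r) (l := l) _ _); cf_auto
  | |- cf (fun t => count (@?P t) (@?l t)) =>
      refine (cf_count (P := P) (l := l) _ _); cf_auto
  | |- cf (fun t => nat_of_bool (conv (@?s t) (@?e t) (@?x t) (@?a t))) =>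
      refine (cp_conv (s := s) (e := e) (x := x) (a := a) _ _ _ _); cf_auto
  end.

(** * Equivalence structures and partial isomorphisms *)

Section EqStruct.
Variable A : eqstruct.

Lemma erel_refl x : x \in dom A -> erel A x x.
Proof. by move=> Ax; have [] := erel_equiv (e := A) Ax Ax Ax. Qed.

Lemma erel_eql x y : erel A x y -> erel A x =1 erel A y.
Proof.
move=> Exy z; have /andP[Ax Ay] := erel_dom Exy.
case Az : (z \in dom A); first by have [_ ->] := erel_equiv (e := A) Ax Ay Az.
by apply/idP/idP => /erel_dom; rewrite Az andbF.
Qed.

Lemma erel_sym x y : erel A x y = erel A y x.
Proof.
apply/idP/idP => E; have /andP[Ax Ay] := erel_dom E.
  by rewrite -(erel_eql E) erel_refl.
by rewrite -(erel_eql E) erel_refl.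
Qed.

Lemma erel_trans y x z : erel A x y -> erel A y z -> erel A x z.
Proof. by move=> /erel_eql->. Qed.

Lemma cf_dom : computable_struct A -> cp (fun x => x \in dom A).
Proof. by case=> -[c Hc] _; exists c => x; exact: Hc. Qed.

(** The program for the relation takes two arguments, whereas computability is
phrased here for the single coded pair. *)
Lemma cf_erel : computable_struct A -> cf (fun p => nat_of_bool (erel A p.1 p.2)).
Proof.
case=> _ [c Hc]; exists (Comp c [:: cfst_code; csnd_code]) => -[x y] /=.
apply: comp2 (Hc x y) _ _.
  by rewrite -[X in computes _ _ X](cfstE x y); exact: computes_cfst.
by rewrite -[X in computes _ _ X](csndE x y); exact: computes_csnd.
Qed.

End EqStruct.

Section BackAndForth.
Variables B A : eqstruct.

(** The pairs [u] and [v] can belong to the same partial isomorphism. *)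
Definition matching (u v : nat * nat) :=
  ((u.1 == v.1) == (u.2 == v.2)) && (erel B u.1 v.1 == erel A u.2 v.2).

Definition partial_iso (p : seq (nat * nat)) :=
  all (fun u => [&& u.1 \in dom B, u.2 \in dom A & all (matching u) p]) p.

Lemma partial_isoP p : reflect
  ((forall u, u \in p -> u.1 \in dom B /\ u.2 \in dom A) /\
   (forall u v, u \in p -> v \in p -> matching u v)) (partial_iso p).
Proof.
apply: (iffP allP) => [H|[H1 H2] u pu].
  split=> [u /H /and3P[] //|u v /H /and3P[_ _ /allP]]; exact.
by apply/and3P; have [-> ->] := H1 u pu; split=> //; apply/allP => v; exact: H2.
Qed.

(** When every finite partial isomorphism above [p0] can be extended by one point on
either side, any choice of extensions succeeds, so the first one found will do.
Step [n] of the search treats the number [n] on both sides, hence the value at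
[x] can be read off at stage [x.+1]. *)
Lemma back_and_forth p0 : partial_iso p0 ->
  (forall p x, partial_iso p -> {subset p0 <= p} -> x \in dom B ->
     exists y, partial_iso ((x, y) :: p)) ->
  (forall p y, partial_iso p -> {subset p0 <= p} -> y \in dom A ->
     exists x, partial_iso ((x, y) :: p)) ->
  exists f, [/\ is_iso B A f, forall u, u \in p0 -> f u.1 = u.2 &
    computable_struct B -> computable_struct A -> computable_on (dom B) f].
Proof.
move=> iso0 forth back.
pose I p := partial_iso p && all (fun u : nat * nat => u \in p) p0.
pose R n (p q : seq (nat * nat)) := [&& all (fun u : nat * nat => u \in q) p,
  (n \in dom B) ==> has (fun u : nat * nat => u.1 == n) q &
  (n \in dom A) ==> has (fun u : nat * nat => u.2 == n) q].
have [||F [F0 IF RF cfF]] := @cf_search _ _ I R p0.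
- by rewrite /I iso0; apply/allP.
- move=> n p /andP[isop /allP sub0].
  have [q [isoq subq Hq]] : exists q, [/\ partial_iso q, {subset p <= q} &
      (n \in dom B) ==> has (fun u : nat * nat => u.1 == n) q].
    case Bn : (n \in dom B); last by exists p; split=> // u.
    have [y iso] := forth p n isop sub0 Bn.
    exists ((n, y) :: p); split=> //= [u pu|]; last by rewrite eqxx.
    by rewrite inE pu orbT.
  have [r [isor subr Hr]] : exists r, [/\ partial_iso r, {subset q <= r} &
      (n \in dom A) ==> has (fun u : nat * nat => u.2 == n) r].
    case An : (n \in dom A); last by exists q; split=> // u.
    have [|y iso] := back q n isoq _ An; first by move=> u /sub0 /subq.
    exists ((y, n) :: q); split=> //= [u pu|]; last by rewrite eqxx.
    by rewrite inE pu orbT.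
  exists r; rewrite /I isor /R /= Hr andbT; apply/and3P; split.
  + by apply/allP => u /sub0 /subq /subr.
  + by apply/allP => u /subq /subr.
  apply/implyP => Bn; move: Hq; rewrite Bn => /hasP[u qu eu].
  by apply/hasP; exists u => //; exact: subr.
have isoF n : partial_iso (F n) by have /andP[] := IF n.
have subF m n : m <= n -> {subset F m <= F n}.
  move=> le; rewrite -(subnK le); elim: (n - m) => // k IH u /IH.
  by have /and3P[/allP H _ _] := RF (k + m); exact: H.
have ex x : exists y : nat, (x \in dom B) ==> ((x, y) \in F x.+1).
  case Bx : (x \in dom B); last by exists 0.
  have /and3P[_] := RF x; rewrite Bx => /hasP[[x' y] Hu /eqP /= ex] _.
  by exists y; rewrite -ex in Hu *.
pose f x := ex_minn (ex x).
have fP x : x \in dom B -> (x, f x) \in F x.+1.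
  by rewrite /f; case: ex_minnP => y + _ Bx; rewrite Bx.
have matchF m n u v : u \in F m -> v \in F n -> matching u v.
  move=> Hu Hv; have /partial_isoP[_] := isoF (maxn m n); apply.
    by apply: subF Hu; exact: leq_maxl.
  by apply: subF Hv; exact: leq_maxr.
have domF n u : u \in F n -> u.1 \in dom B /\ u.2 \in dom A.
  by move=> Hu; have /partial_isoP[H _] := isoF n; exact: H.
have fE n u : u \in F n -> f u.1 = u.2.
  move=> Hu; have [Bu _] := domF _ _ Hu.
  have /andP[/= /eqP H _] := matchF _ _ _ _ (fP _ Bu) Hu.
  by apply/eqP; rewrite -H.
exists f; split.
- split.
  + by move=> x /fP /domF[].
  + move=> x y Bx By E; have /andP[/= /eqP H _] := matchF _ _ _ _ (fP _ Bx) (fP _ By).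
    by apply/eqP; rewrite H E.
  + move=> y Ay; have /and3P[_ _] := RF y; rewrite Ay => /hasP[u Hu /eqP <-].
    by exists u.1; [have [] := domF _ _ Hu|exact: fE Hu].
  by move=> x y Bx By; have /andP[_ /eqP] := matchF _ _ _ _ (fP _ Bx) (fP _ By).
- by move=> u Hu; apply: (fE 0); rewrite F0.
move=> cB cA.
have HB := cf_dom cB; have HA := cf_dom cA.
have HEB := cf_erel cB; have HEA := cf_erel cA.
have cF : cf F.
  apply: cfF; first by rewrite /I /partial_iso /matching /=; cf_auto.
  by rewrite /R /=; cf_auto.
have [c Hc] : cf f by apply: cf_min; cf_auto.
by exists c => x _; exact: Hc.
Qed.

End BackAndForth.

Section Isos.
Variables A B C : eqstruct.

Lemma is_iso_comp f g : is_iso A B f -> is_iso B C g -> is_iso A C (g \o f).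
Proof.
case=> fd fi fs fe [gd gi gs ge]; split=> [x /fd /gd //|x y Ax Ay /= E|z|x y Ax Ay].
- by apply: fi => //; apply: gi => //; exact: fd.
- by case/gs => y /fs[x Ax <-] <-; exists x.
by rewrite /= ge ?fe //; exact: fd.
Qed.

Lemma partial_iso_graph f p : is_iso A B f ->
  (forall u, u \in p -> u.1 \in dom A /\ f u.1 = u.2) -> partial_iso A B p.
Proof.
case=> fd fi fs fe H; apply/partial_isoP; split=> [u /H[Au <-]|u v].
  by split=> //; exact: fd.
rewrite /matching => /H[Au <-] /H[Av <-]; rewrite fe // eqxx andbT.
by apply/eqP; apply/eqP/eqP => [->//|]; exact: fi.
Qed.

Lemma partial_iso_swap p :
  partial_iso A B p -> partial_iso B A [seq (u.2, u.1) | u <- p].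
Proof.
case/partial_isoP=> d m; apply/partial_isoP; split.
  by move=> _ /mapP[u /d[? ?] ->].
move=> _ _ /mapP[u pu ->] /mapP[v pv ->].
have /andP[/eqP e1 /eqP e2] := m u v pu pv.
by rewrite /matching /= e1 e2 !eqxx.
Qed.

End Isos.

Section Restriction.
Variables (A : eqstruct) (l : seq nat).

Lemma restr_dom x y : [&& x \in l, y \in l & erel A x y] ->
  (x \in [pred z in dom A | z \in l]) && (y \in [pred z in dom A | z \in l]).
Proof. by case/and3P=> lx ly /erel_dom/andP[Ax Ay]; rewrite !inE Ax Ay lx ly. Qed.

Lemma restr_equiv : {in [pred z in dom A | z \in l] & &,
  equivalence_rel (fun x y => [&& x \in l, y \in l & erel A x y])}.
Proof.
move=> x y z /andP[Ax /= lx] /andP[Ay /= ly] /andP[Az /= lz].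
rewrite lx ly lz /=; exact: (erel_equiv (e := A)).
Qed.

(** Substructures are cut out by lists, which makes them finite. *)
Definition restr : eqstruct := EqStruct restr_dom restr_equiv.

Lemma restr_sub : substructure restr A.
Proof.
by split=> [x /andP[]//|x y /andP[_ /= lx] /andP[_ /= ly]]; rewrite /= lx ly.
Qed.

Lemma restr_fin : finite_struct restr.
Proof. by exists [seq x <- l | x \in dom A] => x; rewrite mem_filter. Qed.

Lemma restr_mem x : x \in l -> x \in dom A -> x \in dom restr.
Proof. by move=> lx Ax; rewrite !inE /= Ax. Qed.

End Restriction.

(** * From weak ultrahomogeneity to computable categoricity *)

Lemma preimage_seq (T : eqType) (f : nat -> T) (P : pred nat) (s : seq T) :
  (forall a, a \in s -> exists2 x, x \in P & f x = a) ->
  exists2 l, (forall x, x \in l -> x \in P) & map f l = s.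
Proof.
elim: s => [|a s IH] H; first by exists [::].
have [|l Hl <-] := IH; first by move=> b sb; apply: H; rewrite inE sb orbT.
have [x Px <-] := H a (mem_head _ _).
by exists (x :: l) => // y; rewrite inE => /orP[/eqP->|/Hl].
Qed.

(** The claim [ext] is the point: over the distinguished elements, a finite partial
isomorphism from [B] to [A] always extends to an isomorphism, obtained as [f]
followed by an automorphism of [A]. *)
Lemma weakly_ultrahomogeneous_cc (A : eqstruct) : computable_struct A ->
  weakly_ultrahomogeneous A -> computably_categorical A.
Proof.
move=> cA [s sA H] B cB [f isof].
have [fd fi fs fe] := isof.
have [l lB Hl] : exists2 l, (forall x, x \in l -> x \in dom B) & map f l = s.
  by apply: preimage_seq => a /sA /fs.
pose p0 := [seq (b, f b) | b <- l].
have ext p : partial_iso B A p -> {subset p0 <= p} ->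
    exists2 h, is_iso B A h & forall u, u \in p -> h u.1 = u.2.
  move=> /partial_isoP[pd pm] sub0.
  pose l1 := [seq f u.1 | u <- p]; pose l2 := [seq u.2 | u <- p].
  (* The partial map p after the inverse of f, made total. *)
  pose phi a := nth 0 l2 (index a l1).
  have phiE u : u \in p -> phi (f u.1) = u.2.
    move=> pu; rewrite /phi.
    have lt : index (f u.1) l1 < size p.
      by rewrite -(size_map (fun u => f u.1)) index_mem; apply/mapP; exists u.
    rewrite (nth_map (0, 0)) //; set v := nth _ _ _.
    have pv : v \in p by exact: mem_nth.
    have fv : f v.1 = f u.1.
      rewrite -[LHS](nth_map (0, 0) 0 (fun u => f u.1)) //.
      by apply: nth_index; apply/mapP; exists u.
    have /andP[/eqP E _] := pm v u pv pu; apply/eqP; rewrite -E; apply/eqP.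
    by apply: fi => //; [have [] := pd v pv|have [] := pd u pu].
  have in1 x : x \in dom (restr A l1) -> exists2 u, u \in p & x = f u.1.
    by case/andP=> _ /= /mapP[u pu ->]; exists u.
  have in2 x : x \in dom (restr A l2) -> exists2 u, u \in p & x = u.2.
    by case/andP=> _ /= /mapP[u pu ->]; exists u.
  have mem1 u : u \in p -> f u.1 \in dom (restr A l1).
    move=> pu; apply: restr_mem; first by apply/mapP; exists u.
    by apply: fd; have [] := pd u pu.
  have mem2 u : u \in p -> u.2 \in dom (restr A l2).
    by move=> pu; apply: restr_mem; [apply/mapP; exists u|have [] := pd u pu].
  have sp a : a \in s -> exists2 u, u \in p & f u.1 = a /\ u.2 = a.
    rewrite -Hl => /mapP[b lb ->]; exists (b, f b) => //.
    by apply: sub0; apply/mapP; exists b.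
  have [|||g isog gE] := H _ _ phi (restr_sub A l1) (restr_fin A l1)
    (restr_sub A l2) (restr_fin A l2).
  - by move=> a /sp[u pu [E1 E2]]; rewrite -{1}E1 -E2 mem1 ?mem2.
  - split.
    + by move=> x /in1[u pu ->]; rewrite phiE // mem2.
    + move=> x y /in1[u pu ->] /in1[v pv ->]; rewrite !phiE // => E.
      have /andP[/eqP H1 _] := pm u v pu pv.
      by congr f; apply/eqP; rewrite H1 E.
    + move=> y /in2[u pu ->]; exists (f u.1); [exact: mem1|exact: phiE].
    move=> x y /in1[u pu ->] /in1[v pv ->]; rewrite !phiE //.
    have /andP[_ /eqP H2] := pm u v pu pv.
    have [[Bu _] [Bv _]] := (pd u pu, pd v pv).
    rewrite (proj2 (restr_sub A l2)) ?mem2 // -H2 -fe //.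
    by rewrite (proj2 (restr_sub A l1)) ?mem1.
  - by move=> a /sp[u pu [E1 E2]]; rewrite -{1}E1 phiE.
  exists (g \o f); first exact: is_iso_comp isog.
  by move=> u pu /=; rewrite gE ?phiE // mem1.
have [|||h [isoh _ ch]] := @back_and_forth B A p0.
- apply: (partial_iso_graph isof) => _ /mapP[b lb ->]; split=> //; exact: lB.
- move=> p x isop sub0 Bx; have [h isoh hE] := ext p isop sub0.
  exists (h x); apply: (partial_iso_graph isoh) => u.
  rewrite inE => /orP[/eqP->//|pu]; split; last exact: hE.
  by have /partial_isoP[d _] := isop; have [] := d u pu.
- move=> p y isop sub0 Ay; have [h isoh hE] := ext p isop sub0.
  have [_ _ /(_ y Ay)[x Bx hx] _] := isoh.
  exists x; apply: (partial_iso_graph isoh) => u.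
  rewrite inE => /orP[/eqP->//|pu]; split; last exact: hE.
  by have /partial_isoP[d _] := isop; have [] := d u pu.
by exists h => //; exact: ch.
Qed.

(** * Class sizes *)

Section Sizes.
Variable A : eqstruct.

Definition touched (s : seq nat) x := has (erel A x) s.

Definition big n x :=
  exists2 l, uniq l /\ size l = n & forall y, y \in l -> erel A x y.

Definition indep (L : seq nat) :=
  all (fun x => x \in dom A) L && pairwise (fun x y => ~~ erel A x y) L.

Lemma big_leq m n x : m <= n -> big n x -> big m x.
Proof.
move=> le [l [ul sl] Hl]; exists (take m l); last by move=> y /mem_take /Hl.
by rewrite take_uniq // size_take_min sl; split=> //; exact/minn_idPl.
Qed.

Lemma big_erel n x y : erel A x y -> big n x -> big n y.
Proof. by move=> E [l Hl H]; exists l => // z /H; rewrite (erel_eql E). Qed.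

(** Pigeonhole: inequivalent elements that are all equivalent to entries of [Z] are
equivalent to different entries. *)
Lemma indep_size X Z : indep X -> all (touched Z) X -> size X <= size Z.
Proof.
case/andP=> /allP dX pX /allP tX; pose k x := find (erel A x) Z.
have kP x : x \in X -> k x < size Z /\ erel A x (nth 0 Z (k x)).
  by move=> /tX tx; split; [rewrite -has_find|exact: nth_find].
have : uniq (map k X).
  move: pX dX kP {tX}; elim: X => //= x X IH /andP[/allP nX /IH{}IH] dX kP.
  rewrite IH ?andbT; first last.
  - by move=> y Xy; apply: kP; rewrite inE Xy orbT.
  - by move=> y Xy; apply: dX; rewrite inE Xy orbT.
  apply/mapP => -[y Xy E]; have := nX y Xy; apply/negP; rewrite negbK.
  have [_ Ex] := kP x (mem_head _ _).
  have [|_ Ey] := kP y; first by rewrite inE Xy orbT.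
  by apply: erel_trans Ex _; rewrite E erel_sym.
move/uniq_leq_size; rewrite size_map -(size_iota 0 (size Z)); apply.
by move=> _ /mapP[x /kP[lt _] ->]; rewrite mem_iota.
Qed.

(** Having at least as many elements is only compared for finite sizes, which
suffices: an infinite class has at least [n] elements for each [n]. *)
Definition almost_uniform := exists s, forall a b n,
  a \in dom A -> b \in dom A -> ~~ touched s a -> ~~ touched s b ->
  big n a -> big n b.

(** Infinitely many classes have at least [n] elements. *)
Definition spread n :=
  forall s, exists2 a, a \in dom A & ~~ touched s a /\ big n a.

(** * Almost uniform structures are weakly ultrahomogeneous *)

Lemma partial_iso_cons p x y : partial_iso A A p -> x \in dom A -> y \in dom A ->
  (forall u, u \in p -> matching A A (x, y) u) -> partial_iso A A ((x, y) :: p).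
Proof.
move=> /partial_isoP[pd pm] Ax Ay H; apply/partial_isoP; split.
  by move=> u; rewrite inE => /orP[/eqP->//|/pd].
have sym u v : matching A A u v = matching A A v u.
  rewrite /matching (eq_sym u.1) (eq_sym u.2).
  by rewrite (erel_sym _ u.1) (erel_sym _ u.2).
move=> u v; rewrite !inE => /orP[/eqP->|pu] /orP[/eqP->|pv].
- by rewrite /matching /= !eqxx !erel_refl.
- exact: H.
- by rewrite sym; exact: H.
exact: pm.
Qed.

(** One pair per class. Its first components are inequivalent, and its second
components meet the same classes as those of [p]. *)
Lemma transversal (p : seq (nat * nat)) : partial_iso A A p ->
  exists q, [/\ {subset q <= p}, indep (map fst q) &
    forall u, u \in p -> exists2 v, v \in q & erel A u.1 v.1].
Proof.
case/partial_isoP=> pd _.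
suff [q [sq iq Hq]] : exists q, [/\ {subset q <= p}, indep (map fst q) &
    forall u, u \in p -> has (fun v => erel A u.1 v.1) q].
  by exists q; split=> // u /Hq/hasP[v]; exists v.
elim: p pd => [|u p IH] pd; first by exists [::].
have [|q [sq iq Hq]] := IH; first by move=> v pv; apply: pd; rewrite inE pv orbT.
have [Au _] := pd u (mem_head _ _).
case Hu : (has (fun v => erel A u.1 v.1) q).
  exists q; split=> // [v /sq|v]; rewrite inE; first by move=> ->; rewrite orbT.
  by case/orP=> [/eqP->|/Hq].
exists (u :: q); split=> [v||v].
- by rewrite !inE => /orP[->//|/sq ->]; rewrite orbT.
- move: iq; rewrite /indep /= Au => /andP[-> ->]; rewrite !andbT /=.
  by rewrite all_map all_predC Hu.
rewrite inE => /orP[/eqP->|/Hq Hv] /=; first by rewrite erel_refl.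
by rewrite Hv orbT.
Qed.

Section Extension.
Variable s : seq nat.
Hypothesis sU : forall a b n, a \in dom A -> b \in dom A ->
  ~~ touched s a -> ~~ touched s b -> big n a -> big n b.

(** If [x] is equivalent to some [u0.1] in the domain, its image is sought in the
class of [u0.2]: this class has as many elements, either because it is the same
class (when it meets [s]) or because of uniformity, and [p] has used equally many
elements of both. Otherwise the image must come from a class that [p] has not
used, and if there were none then [x] and a transversal of the domain would be
inequivalent elements lying in too few classes. *)
Lemma partial_iso_forth p x : partial_iso A A p ->
  (forall a, a \in s -> (a, a) \in p) -> x \in dom A ->
  exists y, partial_iso A A ((x, y) :: p).
Proof.
move=> isop fixp Ax; have /partial_isoP[pd pm] := isop.
have bigE u n : u \in p -> big n u.1 -> big n u.2.
  move=> pu; have [Au1 Au2] := pd u pu.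
  have tE a : a \in s -> erel A u.1 a = erel A u.2 a.
    by move=> /fixp /(pm _ _ pu) /andP[_ /eqP].
  case t1 : (touched s u.1).
    have /hasP[a sa Ea] := t1; apply: big_erel; apply: (erel_trans Ea).
    by rewrite erel_sym -tE.
  have t2 : touched s u.2 = false by rewrite -t1; apply: eq_in_has => a /tE.
  by apply: sU; rewrite ?t1 ?t2.
case Hx : (has (fun u => erel A x u.1) p).
  have /hasP[u0 pu0 Eu0] := Hx.
  pose U := [seq u <- undup p | erel A x u.1].
  have UP u : u \in U = erel A x u.1 && (u \in p) by rewrite mem_filter mem_undup.
  case xU : (x \in map fst U).
    have /mapP[[x' y]] := xU; rewrite UP => /andP[_ pu] /= ex.
    exists y; rewrite -ex in pu.
    have [_ Ay] := pd _ pu.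
    by apply: partial_iso_cons => // v pv; exact: pm.
  have uU1 : uniq (map fst U).
    rewrite map_inj_in_uniq ?filter_uniq ?undup_uniq // => u v.
    rewrite !UP => /andP[_ pu] /andP[_ pv] E.
    have /andP[/eqP H _] := pm u v pu pv; move: H; rewrite E eqxx.
    by case: u v E {pu pv} => [u1 u2] [v1 v2] /= -> /esym/eqP->.
  have bigx : big (size U).+1 x.
    exists (x :: map fst U); first by rewrite /= xU uU1 size_map.
    move=> y; rewrite inE => /orP[/eqP->|/mapP[u Uu ->]]; first exact: erel_refl.
    by move: Uu; rewrite UP => /andP[].
  have [l [ul sl] Hl] := bigE _ _ pu0 (big_erel Eu0 bigx).
  have [y ly nUy] : exists2 y, y \in l & y \notin map snd U.
    apply/hasP; rewrite has_predC; apply/negP => /allP sub.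
    by have := uniq_leq_size ul sub; rewrite sl size_map ltnn.
  have Ey := Hl y ly; have /andP[_ Ay] := erel_dom Ey.
  exists y; apply: partial_iso_cons => // u pu.
  have /andP[_ /eqP Em] := pm u0 u pu0 pu.
  have Ex : erel A x u.1 = erel A y u.2.
    by rewrite (erel_eql Eu0) Em (erel_eql Ey).
  rewrite /matching /= Ex eqxx andbT.
  case Exu : (erel A x u.1).
    have Uu : u \in U by rewrite UP Exu.
    have -> : (x == u.1) = false.
      by apply/eqP => E; move: xU; rewrite E; case/mapP; exists u.
    have -> // : (y == u.2) = false.
    by apply/eqP => E; move: nUy; rewrite E => /mapP[]; exists u.
  have -> : (x == u.1) = false.
    by apply/eqP => E; rewrite -E erel_refl in Exu.
  have -> // : (y == u.2) = false.
  by apply/eqP => E; rewrite Ex -E erel_refl in Exu.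
have [q [sq iq Hq]] := transversal isop.
have ix : indep (x :: map fst q).
  move: iq; rewrite /indep /= Ax => /andP[-> ->]; rewrite !andbT /=.
  apply/allP => _ /mapP[u /sq pu ->]; apply/negP => E.
  by move: Hx => /negP; apply; apply/hasP; exists u.
have [y Xy ty] : exists2 y, y \in dom A & ~~ touched (map snd q) y.
  apply: NNPP => H.
  have : all (touched (map snd q)) (x :: map fst q).
    apply/allP => y /(allP (proj1 (andP ix))) Ay.
    by apply/negPn/negP => ty; apply: H; exists y.
  by move/(indep_size ix); rewrite /= !size_map ltnn.
exists y; apply: partial_iso_cons => // u pu.
have [v qv Ev] := Hq u pu.
have nx : erel A x u.1 = false.
  by apply/negP => E; move/hasP: Hx; apply; exists u.
have ny : erel A y u.2 = false.
  have /andP[_ /eqP Em] := pm u v pu (sq _ qv); rewrite Ev in Em.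
  move: ty => /negP ty; apply/negP => E; apply: ty; apply/hasP.
  exists v.2; first exact: map_f.
  by apply: erel_trans E _; rewrite -Em.
rewrite /matching /= nx ny eqxx andbT.
have -> : (x == u.1) = false by apply/eqP => E; rewrite -E erel_refl in nx.
by have -> : (y == u.2) = false by apply/eqP => E; rewrite -E erel_refl in ny.
Qed.

End Extension.

Lemma almost_uniform_weakly_ultrahomogeneous :
  almost_uniform -> weakly_ultrahomogeneous A.
Proof.
case=> s0 H0; pose s := [seq a <- s0 | a \in dom A].
have sA a : a \in s -> a \in dom A by rewrite mem_filter => /andP[].
have tE x : touched s x = touched s0 x.
  apply/hasP/hasP => -[a sa Ea]; exists a => //.
    by move: sa; rewrite mem_filter => /andP[].
  by rewrite mem_filter sa andbT; have /andP[] := erel_dom Ea.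
have sU a b n : a \in dom A -> b \in dom A ->
    ~~ touched s a -> ~~ touched s b -> big n a -> big n b.
  by rewrite !tE; exact: H0.
exists s => // B C f [sBd sBe] [l Hl] [sCd sCe] _ sBC isof fixf.
pose p0 := [seq (x, f x) | x <- l].
have [fd fi fs fe] := isof.
have iso0 : partial_iso A A p0.
  apply/partial_isoP; split=> [_ /mapP[x lx ->]|_ _ /mapP[x lx ->] /mapP[y ly ->]].
    by rewrite -Hl in lx; split=> /=; [exact: sBd|apply: sCd; exact: fd].
  rewrite -Hl in lx; rewrite -Hl in ly; rewrite /matching /= -sBe // -sCe ?fd //.
  rewrite fe // eqxx andbT; apply/eqP; apply/eqP/eqP => [->//|]; exact: fi.
have fix0 a : a \in s -> (a, a) \in p0.
  move=> sa; apply/mapP; exists a; last by rewrite fixf.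
  by rewrite -Hl; have /andP[] := sBC a sa.
have [||g [isog gE _]] := @back_and_forth A A p0 iso0.
- move=> p x isop sub0 Ax; apply: (partial_iso_forth sU) => // a /fix0; exact: sub0.
- move=> p y isop sub0 Ay.
  have [a sa|x isox] := partial_iso_forth sU (partial_iso_swap isop) _ Ay.
    by apply/mapP; exists (a, a) => //; exact/sub0/fix0.
  exists x; have := partial_iso_swap isox; rewrite /= -map_comp.
  by rewrite map_id_in // => -[].
by exists g => // x; rewrite Hl => lx; apply: (gE (x, f x)); apply/mapP; exists x.
Qed.

(** * Structures that are not almost uniform *)

Definition allowed (K : option nat) n := if K is Some k then n <= k else true.

(** Either infinitely many classes exceed each finite bound, and all bounds are
allowed; non-uniformity then gives new finite classes again and again. Or there
is a largest [k] such that infinitely many classes have more than [k] elements.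
Then almost all classes have at most [k.+1] elements, and by non-uniformity
infinitely many of them have at most [k]. *)
Lemma not_almost_uniform : ~ almost_uniform -> exists K,
  (forall n, allowed K n -> spread n.+1) /\
  (forall m, exists2 n, allowed K n & exists L, [/\ size L = m, indep L &
     forall a, a \in L -> ~ big n.+1 a]).
Proof.
move=> nu.
have alt s : exists a b n, [/\ a \in dom A, b \in dom A, ~~ touched s a /\
    ~~ touched s b, big n a & ~ big n b].
  apply: NNPP => H; apply: nu; exists s => a b n Aa Ab ta tb bn.
  by apply: NNPP => nb; apply: H; exists a, b, n.
have indep_cons b L : b \in dom A -> ~~ touched L b -> indep L -> indep (b :: L).
  move=> Ab tb; rewrite /indep /= Ab => /andP[-> ->]; rewrite !andbT /=.
  by rewrite all_predC.
have grow (P : nat -> Prop) n0 : P n0 -> (forall m n, P m -> P n -> P (maxn m n)) ->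
  (forall L, exists b n, [/\ P n, b \in dom A, ~~ touched L b & ~ big n.+1 b]) ->
  forall m, exists2 n, P n & exists L, [/\ size L = m, indep L &
     forall a, a \in L -> ~ big n.+1 a].
  move=> P0 Pmax H; elim=> [|m [n Pn [L [sL iL bL]]]]; first by exists n0; [|exists [::]].
  have [b [n' [Pn' Ab tb bb]]] := H L.
  exists (maxn n n'); first exact: Pmax.
  exists (b :: L); split; [by rewrite /= sL|exact: indep_cons|].
  move=> a; rewrite inE => /orP[/eqP->|La] B.
    by apply: bb; apply: big_leq B; rewrite ltnS leq_maxr.
  by apply: (bL a La); apply: big_leq B; rewrite ltnS leq_maxl.
have spread1 : spread 1.
  move=> s; have [a [b [n [Aa _ [ta _] _ _]]]] := alt s.
  exists a => //; split=> //; exists [:: a] => // y; rewrite inE => /eqP->.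
  exact: erel_refl.
case: (classic (forall n, spread n.+1)) => [all|nall].
  exists None; split=> [n _|]; first exact: all.
  apply: (grow (allowed None) 0) => // L.
  have [a [b [n [_ Ab [_ tb] _ nb]]]] := alt L.
  by exists b, n; split=> // B; apply: nb; exact: big_leq B.
have [k Sk nSk] : exists2 k, spread k.+1 & ~ spread k.+2.
  apply: NNPP => H; apply: nall; elim=> // n IH.
  by apply: NNPP => nS; apply: H; exists n.
exists (Some k); split=> [n le s|].
  have [a Aa [ta ba]] := Sk s; exists a => //; split=> //.
  exact: big_leq ba.
have [s1 Hs1] : exists s, forall a, a \in dom A -> ~~ touched s a -> ~ big k.+2 a.
  apply: NNPP => H; apply: nSk => s; apply: NNPP => H2; apply: H; exists s.
  by move=> a Aa ta ba; apply: H2; exists a.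
apply: (grow (allowed (Some k)) k) => /= [//|m n|L]; first by rewrite geq_max => -> ->.
have [a [b [n [Aa Ab [ta tb] ba nb]]]] := alt (s1 ++ L).
move: ta tb; rewrite /touched !has_cat !negb_or => /andP[ta _] /andP[_ tb].
exists b, k; split=> // B; apply: nb; apply: big_leq B.
rewrite leqNgt; apply/negP => lt; apply: (Hs1 a Aa ta); exact: big_leq ba.
Qed.

End Sizes.

(** * Diagonalisation *)

Section Construction.
Variables (A : eqstruct) (K : option nat).

(** A number [i] codes the candidate consisting of a bound and of a list. *)
Definition cand_bound i := (dec i : nat * seq nat).1.
Definition cand_list i := (dec i : nat * seq nat).2.

(** The candidate [i] is suitable for the program [e] and has not been refuted by
the elements of [A] below [s]. The length [e + e + 1] exceeds the number of
blocks that [e] must leave alone. *)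
Definition valid e s i :=
  [&& allowed K (cand_bound i), size (cand_list i) == (e + e).+1,
    indep A (cand_list i) &
    all (fun a => count (fun b => erel A a b) (iota 0 s) <= cand_bound i)
      (cand_list i)].

Lemma guess_ex e s : exists i, (s <= i) || valid e s i.
Proof. by exists s; rewrite leqnn. Qed.

(** The least candidate not yet refuted; the first disjunct only makes the search
total, and a guess [i] with [i < s] is valid. *)
Definition guess e s := ex_minn (guess_ex e s).

(** The size of the block of [x], at present. It depends on the relation of the
copy only, so it never decreases, even if the block is redirected. *)
Definition bsize (h : seq nat) x :=
  count (fun y => erel A (nth 0 h x) (nth 0 h y)) (iota 0 (size h)).

Definition reached e s i x := has (fun a => conv s e x a) (cand_list i).

(** The candidate [i] can no longer be consistent with an isomorphism [e]: some
element of its list is the value at an element whose class is too large. *)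
Definition secured e s i h :=
  has (fun x => reached e s i x && (cand_bound i < bsize h x))
    (iota 0 (size h)).

(** The class of [a] contains an element below [e], or it is the image of a block
that contains a number below [e]. A missing entry of [h] is read as 0, which is
itself below [e] then. *)
Definition blocked e (h : seq nat) a :=
  has (fun r => erel A a (nth 0 h r) || erel A a r) (iota 0 e).

Definition may_act e s i h :=
  [&& i < s, ~~ secured e s i h &
    has (fun x => reached e s i x && ~~ blocked e h (nth 0 h x)) (iota 0 (size h))].

Definition good (h : seq nat) :=
  pairwise (fun x y => x != y) h && all (fun a => a \in dom A) h.

Definition same_pattern (h l : seq nat) :=
  (size h <= size l) && all (fun x => all (fun y =>
    erel A (nth 0 h x) (nth 0 h y) == erel A (nth 0 l x) (nth 0 l y))
    (iota 0 (size h))) (iota 0 (size h)).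

Definition kept (b : bool) e (h l : seq nat) :=
  all (fun x => b && ~~ blocked e h (nth 0 h x) || (nth 0 l x == nth 0 h x))
    (iota 0 (size h)).

Definition attended s := (dec s : nat * nat).1.

(** The conditions on the next sequence [l] are stated declaratively and are
decidable; the first solution is found by search. *)
Definition step_rel s h l :=
  let e := attended s in
  let i := guess e s in
  let b := may_act e s i h in
  [&& same_pattern h l, kept b e h l, b ==> secured e s i l &
    all (fun a => (a \in dom A) ==> (a \in l)) (iota 0 s)].

Lemma cp_good : computable_struct A -> cp good.
Proof.
by move=> cA; have HD := cf_dom cA; have HE := cf_erel cA; rewrite /good; cf_auto.
Qed.

Lemma cp_step : computable_struct A ->
  cp (fun p : nat * (seq nat * seq nat) => step_rel p.1 p.2.1 p.2.2).
Proof.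
move=> cA; have HD := cf_dom cA; have HE := cf_erel cA.
have HK : cp (allowed K) by rewrite /allowed; case: (K) => [k|]; cf_auto.
have Hg : cf (fun p : nat * nat => guess p.1 p.2).
  rewrite /guess; apply: (cf_min (fun p : nat * nat => guess_ex p.1 p.2)).
  rewrite /valid /indep /cand_bound /cand_list; cf_auto.
have Hguess T (cT : coding T) (e s : T -> nat) : cf e -> cf s ->
  cf (fun t => guess (e t) (s t)) by exact: cf_app2.
have Hsecured T (cT : coding T) (e s i : T -> nat) (h : T -> seq nat) :
    cf e -> cf s -> cf i -> cf h -> cp (fun t => secured (e t) (s t) (i t) (h t)).
  by move=> *; rewrite /secured /bsize /reached /cand_bound /cand_list; cf_auto.
have Hmay_act T (cT : coding T) (e s i : T -> nat) (h : T -> seq nat) :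
    cf e -> cf s -> cf i -> cf h -> cp (fun t => may_act (e t) (s t) (i t) (h t)).
  move=> *; rewrite /may_act /blocked /reached /cand_list; cf_auto; apply: Hsecured => //.
have Hatt : cf attended by rewrite /attended; cf_auto.
rewrite /step_rel /same_pattern /kept /blocked; cf_auto.
- by apply: Hmay_act; [| |apply: Hguess|]; cf_auto.
- by apply: Hmay_act; [| |apply: Hguess|]; cf_auto.
by apply: Hsecured; [| |apply: Hguess|]; cf_auto.
Qed.

Lemma goodP h : reflect (uniq h /\ forall a, a \in h -> a \in dom A) (good h).
Proof.
rewrite /good; have -> : pairwise (fun x y => x != y) h = uniq h.
  by rewrite uniq_pairwise.
by apply: (iffP andP) => -[u /allP d].
Qed.

Lemma same_patternP h l : reflect (size h <= size l /\
    forall x y, x < size h -> y < size h ->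
      erel A (nth 0 h x) (nth 0 h y) = erel A (nth 0 l x) (nth 0 l y))
  (same_pattern h l).
Proof.
apply: (iffP andP) => -[le H]; split=> //.
  move=> x y ltx lty; apply/eqP.
  have Ix z : z < size h -> z \in iota 0 (size h) by rewrite mem_iota.
  exact: (allP (allP H x (Ix x ltx)) y (Ix y lty)).
apply/allP => x; rewrite mem_iota => ltx.
by apply/allP => y; rewrite mem_iota => lty; apply/eqP/H.
Qed.

Lemma bsize_mono h l x : same_pattern h l -> x < size h ->
  bsize h x <= bsize l x.
Proof.
case/same_patternP=> le H ltx; rewrite /bsize -(subnKC le) iotaD count_cat.
apply: leq_trans (leq_addr _ _).
rewrite (@eq_in_count _ _ (fun y => erel A (nth 0 l x) (nth 0 l y))) // => y.
by rewrite mem_iota => lty; exact: H.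
Qed.

Lemma secured_mono e s t i h l : s <= t -> same_pattern h l ->
  secured e s i h -> secured e t i l.
Proof.
move=> st hl /hasP[x]; rewrite mem_iota => /= ltx /andP[/hasP[a La Ha] big].
have /same_patternP[le _] := hl.
apply/hasP; exists x; first by rewrite mem_iota /= (leq_trans ltx).
rewrite (leq_trans big (bsize_mono hl ltx)) andbT.
by apply/hasP; exists a => //; exact: conv_mono Ha.
Qed.

(** The block of [x0] is sent to the elements of a class that [h] does not meet, and
new numbers are appended to the block until it has [n.+1] elements. Its previous
image is released, to be covered again by new numbers. *)
Lemma move_block h x0 n : good h -> x0 < size h -> bsize h x0 <= n ->
  spread A n.+1 -> exists l, [/\ good l, same_pattern h l, n < bsize l x0 &
    forall y, y < size h -> ~~ erel A (nth 0 h x0) (nth 0 h y) ->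
      nth 0 l y = nth 0 h y].
Proof.
move=> /goodP[uh dh] ltx0 small /(_ h)[c Ac [tc [l [ul sl] cl]]].
set blk := [seq y <- iota 0 (size h) | erel A (nth 0 h x0) (nth 0 h y)].
have sblk : size blk <= n by rewrite size_filter.
have in_blk y : (y \in blk) = (y < size h) && erel A (nth 0 h x0) (nth 0 h y).
  by rewrite mem_filter mem_iota /= andbC.
pose N := size h + (n.+1 - size blk).
(* The new sequence F has length N; its entries at inl are those in the moved
   block, and pos numbers them consecutively along l. *)
pose inl y := (size h <= y) || (y \in blk).
pose pos y := if y < size h then index y blk else size blk + (y - size h).
pose F y := if inl y then nth 0 l (pos y) else nth 0 h y.
have pos_lt y : y < N -> inl y -> pos y < size l.
  rewrite sl /N /inl /pos ltnS; case: (ltnP y (size h)) => [lt _ /= by_|le]; last by lia.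
  by rewrite -index_mem in by_; exact: leq_trans (ltnW by_) sblk.
have F_l y : y < N -> inl y -> F y \in l.
  by move=> lt iy; rewrite /F iy mem_nth // pos_lt.
have F_h y : ~~ inl y -> F y = nth 0 h y /\ F y \in h.
  move=> niy; rewrite /F (negbTE niy); split=> //; apply: mem_nth.
  by move: niy; rewrite negb_or -ltnNge => /andP[].
have notc a : a \in h -> ~~ erel A c a.
  by move=> ha; apply: contra tc => E; apply/hasP; exists a.
have pos_inj y z : y < N -> z < N -> inl y -> inl z -> pos y = pos z -> y = z.
  rewrite /inl /pos => ltyN ltzN.
  case: (ltnP y) => lty; case: (ltnP z) => ltz //= iy iz E.
  - by rewrite -(nth_index 0 iy) E nth_index.
  - by move: iy; rewrite -index_mem E ltnNge leq_addr.
  - by move: iz; rewrite -index_mem -E ltnNge leq_addr.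
  by lia.
have F_inj : {in [pred y | y < N] &, injective F}.
  move=> y z; rewrite !inE => lty ltz E.
  case iy : (inl y); case iz : (inl z).
  - apply: pos_inj => //; move: E; rewrite /F iy iz => /eqP.
    by rewrite nth_uniq ?pos_lt // => /eqP.
  - have [_ Fz] := F_h z (negbT iz); have := notc _ Fz.
    by rewrite -E cl // F_l.
  - have [_ Fy] := F_h y (negbT iy); have := notc _ Fy.
    by rewrite E cl // F_l.
  have [ey _] := F_h y (negbT iy); have [ez _] := F_h z (negbT iz).
  move: E (iy) (iz); rewrite ey ez /inl => /eqP.
  case: leqP => //= lty' + _; case: leqP => //= ltz' + _.
  by rewrite nth_uniq // => /eqP.
have nthF y : y < N -> nth 0 (mkseq F N) y = F y by move=> lt; rewrite nth_mkseq.
have ltN y : y < size h -> y < N by move=> lt; rewrite /N ltn_addr.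
have bE y : y < size h -> inl y = erel A (nth 0 h x0) (nth 0 h y).
  by move=> lt; rewrite /inl leqNgt lt in_blk lt.
have Ah y : y < size h -> nth 0 h y \in dom A by move=> lt; apply: dh; exact: mem_nth.
have ix0 : inl x0 by rewrite bE // erel_refl // Ah.
have cF y : y < N -> erel A c (F y) = inl y.
  move=> lt; case iy : (inl y); first by apply: cl; exact: F_l.
  by have [_ Fy] := F_h y (negbT iy); apply: negbTE; exact: notc.
exists (mkseq F N); split.
- apply/goodP; split; first by apply/mkseq_uniqP.
  move=> a /mapP[y]; rewrite mem_iota /= => lt ->.
  case iy : (inl y); last by have [_ /dh] := F_h y (negbT iy).
  by have := cl _ (F_l y lt iy) => /erel_dom/andP[].
- apply/same_patternP; rewrite size_mkseq; split=> [|x y ltx lty].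
    by rewrite /N leq_addr.
  rewrite !nthF ?ltN //.
  case ix : (inl x).
    have -> : erel A (F x) (F y) = inl y.
      by rewrite -cF ?ltN // (erel_eql (x := c) (y := F x)) // cF ?ltN.
    by rewrite bE // (erel_eql (x := nth 0 h x0) (y := nth 0 h x)) // -bE.
  case iy : (inl y).
    have -> : erel A (F x) (F y) = inl x.
      by rewrite erel_sym -cF ?ltN // (erel_eql (x := c) (y := F y)) // cF ?ltN.
    rewrite erel_sym bE // (erel_eql (x := nth 0 h x0) (y := nth 0 h y)) //.
    by rewrite -bE.
  by have [-> _] := F_h x (negbT ix); have [-> _] := F_h y (negbT iy).
- rewrite /bsize size_mkseq nthF ?ltN // -sl.
  rewrite (@eq_in_count _ _ (fun y : nat => F y \in l)) => [|y]; last first.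
    rewrite mem_iota /= => lt; rewrite nthF //.
    rewrite -(erel_eql (x := c) (y := F x0)) ?cF ?(ltN x0) //.
    case iy : (inl y); first by rewrite F_l.
    by apply/esym/negP => /cl; rewrite cF // iy.
  have -> : count (fun y => F y \in l) (iota 0 N) =
      count (fun a => a \in l) (mkseq F N) by rewrite count_map.
  rewrite -size_filter.
  apply: uniq_leq_size => // a la.
  rewrite mem_filter la /=; apply/mapP.
  have lta : index a l < n.+1 by rewrite -sl index_mem.
  case: (ltnP (index a l) (size blk)) => lt.
    have Hy : nth 0 blk (index a l) \in blk by exact: mem_nth.
    exists (nth 0 blk (index a l)).
      by move: Hy; rewrite in_blk mem_iota => /andP[/ltN].
    have := Hy; rewrite in_blk => /andP[lty _].
    rewrite /F /inl Hy orbT /pos lty index_uniq ?nth_index //.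
    by rewrite filter_uniq // iota_uniq.
  exists (size h + (index a l - size blk)).
    by rewrite mem_iota /= /N ltn_add2l; lia.
  rewrite /F /inl leq_addr /= /pos ltnNge leq_addr /=.
  by rewrite addKn subnKC // nth_index.
move=> y lty ny; rewrite nthF ?ltN // /F /inl leqNgt lty /= in_blk lty.
by rewrite (negbTE ny).
Qed.

(** Covering all small elements of [A] at each step makes the limit surjective. *)
Lemma fill h s : good h -> exists r, good (h ++ r) /\
  forall a, a < s -> a \in dom A -> a \in h ++ r.
Proof.
move=> /goodP[uh dh].
exists [seq a <- iota 0 s | (a \in dom A) && (a \notin h)]; split.
  apply/goodP; split.
    rewrite cat_uniq uh filter_uniq ?iota_uniq // andbT.
    by apply/hasPn => a; rewrite mem_filter => /andP[/andP[]].
  move=> a; rewrite mem_cat => /orP[/dh //|].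
  by rewrite mem_filter => /andP[/andP[]].
move=> a lt Aa; rewrite mem_cat mem_filter mem_iota Aa /= lt.
by case: (a \in h).
Qed.

Lemma same_pattern_cat h l r : same_pattern h l -> same_pattern h (l ++ r).
Proof.
case/same_patternP=> le H; apply/same_patternP; split=> [|x y ltx lty].
  by rewrite size_cat (leq_trans le) ?leq_addr.
by rewrite H // !nth_cat !(leq_trans _ le).
Qed.

Hypothesis allowed_spread : forall n, allowed K n -> spread A n.+1.

Lemma step_ex s h : good h -> exists l, good l && step_rel s h l.
Proof.
move=> gh; rewrite /step_rel; set e := attended s; set i := guess e s.
set b := may_act e s i h.
suff [l [gl hl kl sl]] : exists l, [/\ good l, same_pattern h l, kept b e h l &
    b ==> secured e s i l].
  have [r [gr Hr]] := fill s gl; exists (l ++ r).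
  rewrite gr same_pattern_cat //=; apply/and3P; split.
  - apply/allP => x; rewrite mem_iota /= => ltx.
    have /same_patternP[le _] := hl.
    rewrite nth_cat (leq_trans ltx le); apply: (allP kl).
    by rewrite mem_iota.
  - apply/implyP => Hb; move: sl; rewrite Hb /=; apply: secured_mono => //.
    apply/same_patternP; split=> [|x y ltx lty]; first by rewrite size_cat leq_addr.
    by rewrite !nth_cat ltx lty.
  apply/allP => a; rewrite mem_iota => /= lt; apply/implyP; exact: Hr.
case Hb : b; last first.
  exists h; split=> //; last by apply/allP => x _ /=.
  by apply/same_patternP.
move: Hb; rewrite /b /may_act => /and3P[lti nsecured /hasP[x0]].
rewrite mem_iota => /= ltx0 /andP[rx0 bx0].
have vi : valid e s i.
  move: lti; rewrite /i /guess; case: ex_minnP => m /orP[le|//] _ lt.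
  by move: lt; rewrite ltnNge le.
have [n_ok _ _ _] := and4P vi.
have [|l [gl hl big Hl]] := move_block gh ltx0 _ (allowed_spread n_ok).
  rewrite leqNgt; apply: contra nsecured => big.
  by apply/hasP; exists x0; rewrite ?mem_iota //= rx0.
exists l; split=> //.
  apply/allP => x; rewrite mem_iota => /= ltx.
  case Hx : (blocked e h (nth 0 h x)) => //=; apply/eqP; apply: Hl => //.
  apply: contra bx0 => E; apply: (etrans _ Hx).
  by apply: eq_in_has => r _; rewrite !(erel_eql E).
apply/hasP; exists x0; last by rewrite rx0.
have /same_patternP[le _] := hl.
by rewrite mem_iota /= (leq_trans ltx0).
Qed.

Hypothesis few_large : forall m, exists2 n, allowed K n &
  exists L, [/\ size L = m, indep A L & forall a, a \in L -> ~ big A n.+1 a].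

Section Run.
Variable H : nat -> seq nat.
Hypothesis H_good : forall s, good (H s).
Hypothesis H_step : forall s, step_rel s (H s) (H s.+1).

Definition acts s :=
  may_act (attended s) s (guess (attended s) s) (H s).

Lemma run_dom s x : x < size (H s) -> nth 0 (H s) x \in dom A.
Proof. by move=> lt; have /goodP[_] := H_good s; apply; exact: mem_nth. Qed.

Lemma run_pattern s t : s <= t -> same_pattern (H s) (H t).
Proof.
move=> le; rewrite -(subnK le); elim: (t - s) => [|k /same_patternP[le1 H1]].
  by apply/same_patternP.
have /and4P[/same_patternP[le2 H2] _ _ _] := H_step (k + s).
apply/same_patternP; split=> [|x y ltx lty]; first exact: leq_trans le2.
by rewrite H1 // H2 // (leq_trans _ le1).
Qed.

Lemma run_size s t : s <= t -> size (H s) <= size (H t).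
Proof. by case/run_pattern/same_patternP. Qed.

Lemma run_erel s t x y : s <= t -> x < size (H s) -> y < size (H s) ->
  erel A (nth 0 (H s) x) (nth 0 (H s) y) = erel A (nth 0 (H t) x) (nth 0 (H t) y).
Proof. by case/run_pattern/same_patternP => _; apply. Qed.

Lemma run_covers s a : a < s -> a \in dom A -> a \in H s.+1.
Proof.
move=> lt Aa; have /and4P[_ _ _ /allP cov] := H_step s.
by have := cov a; rewrite mem_iota Aa; apply.
Qed.

Lemma run_unbounded m : exists s, m <= size (H s).
Proof.
have [_ _ [L [sL /andP[/allP dL pL] _]]] := few_large m.
have uL : uniq L.
  rewrite uniq_pairwise; apply: (sub_in_pairwise _ (allss L)) pL => x y Lx _.
  by apply: contra => /eqP <-; exact/erel_refl/dL.
have [s Hs] : exists s, forall a, a \in L -> a < s.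
  elim: (L) => [|a L' [s IH]]; first by exists 0.
  exists (maxn a.+1 s) => b; rewrite inE => /orP[/eqP->|/IH lt].
    by rewrite leq_maxl.
  by rewrite (leq_trans lt) // leq_maxr.
exists s.+1; rewrite -sL; apply: uniq_leq_size => // a La.
by apply: run_covers; [exact: Hs|exact: dL].
Qed.

Lemma bounded_mono_stable (f : nat -> nat) b :
  (forall s t, s <= t -> f s <= f t) -> (forall s, f s <= b) ->
  exists s0, forall s, s0 <= s -> f s = f s0.
Proof.
move=> mono; elim: b => [|b IH] bd.
  by exists 0 => s _; move: (bd s) (bd 0); rewrite !leqn0 => /eqP-> /eqP->.
case: (classic (exists s, f s = b.+1)) => [[s0 E]|nE].
  by exists s0 => s le; apply/eqP; rewrite eqn_leq (mono _ _ le) andbT E.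
apply: IH => s; move: (bd s); rewrite leq_eqVlt => /orP[/eqP E|//].
by case: nE; exists s.
Qed.

Lemma csize_big s n a : ~ big A n.+1 a -> count (fun b => erel A a b) (iota 0 s) <= n.
Proof.
move=> nb; rewrite leqNgt; apply/negP => lt; apply: nb; apply: big_leq lt _.
exists [seq b <- iota 0 s | erel A a b].
  by rewrite filter_uniq ?iota_uniq // size_filter.
by move=> b; rewrite mem_filter => /andP[].
Qed.

Lemma guess_stable e : exists s0, forall s, s0 <= s -> guess e s = guess e s0.
Proof.
have [n nK [L [sL iL bL]]] := few_large (e + e).+1.
(* A candidate that is true is never refuted, hence bounds the guess. *)
apply: (@bounded_mono_stable _ (enc (n, L))) => [s t le|s].
  rewrite /guess; case: ex_minnP => i Hi min; case: ex_minnP => j Hj _.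
  apply: min; case/orP: Hj => [/(leq_trans le) -> //|/and4P[a b c /allP d]].
  apply/orP; right; apply/and4P; split=> //; apply/allP => x /d.
  apply: leq_trans; rewrite -(subnKC le) iotaD count_cat; exact: leq_addr.
rewrite /guess; case: ex_minnP => i _; apply; apply/orP; right.
rewrite /valid /cand_bound /cand_list encK /= nK sL eqxx iL /=.
by apply/allP => a /bL; exact: csize_big.
Qed.

(** Once the guess is constant, an action secures it, and a secured candidate
allows no further action. *)
Lemma finite_action e : exists s0, forall s, s0 <= s ->
  ~~ ((attended s == e) && acts s).
Proof.
have [s1 H1] := guess_stable e.
case: (classic (exists2 s, s1 <= s & (attended s == e) && acts s)); last first.
  move=> none; exists s1 => s le; apply/negP => act; apply: none.
  by exists s.
case=> s2 le2 /andP[/eqP Ee act].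
exists s2.+1 => s lt; apply/negP => /andP[/eqP Es /and3P[_ /negP nsecured _]].
apply: nsecured; have le : s1 <= s by apply: leq_trans le2 (ltnW lt).
have /and4P[_ _ + _] := H_step s2.
rewrite -[may_act _ _ _ _]/(acts s2) act /= Ee Es (H1 _ le2) (H1 _ le).
by apply: secured_mono; [exact: ltnW|exact: run_pattern].
Qed.

Lemma quiet m : exists s0, forall s, s0 <= s -> attended s < m -> ~~ acts s.
Proof.
have [|k _|s0 Hs] := @bounded_stage (fun s0 e => forall s, s0 <= s ->
  ~~ ((attended s == e) && acts s)) m.
- by move=> k s t le Hs r ler; apply: Hs; exact: leq_trans ler.
- exact: finite_action.
exists s0 => s le lt; have := Hs _ lt s le.
by rewrite eqxx.
Qed.

Lemma run_kept s x : x < size (H s) ->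
  (acts s -> blocked (attended s) (H s) (nth 0 (H s) x)) ->
  nth 0 (H s.+1) x = nth 0 (H s) x.
Proof.
move=> lt Hb; have /and4P[_ /allP kp _ _] := H_step s.
have Ix : x \in iota 0 (size (H s)) by rewrite mem_iota.
move: (kp x Ix); rewrite -[may_act _ _ _ _]/(acts s).
case act : (acts s); last by move/eqP.
by rewrite Hb // => /eqP.
Qed.

(** An entry is constant from [s0] on if the programs below [m] no longer act and
the others find it blocked. *)
Lemma stays m s0 x : (forall s, s0 <= s -> attended s < m -> ~~ acts s) ->
  x < size (H s0) ->
  (forall s, s0 <= s -> m <= attended s -> nth 0 (H s) x = nth 0 (H s0) x ->
     blocked (attended s) (H s) (nth 0 (H s) x)) ->
  forall s, s0 <= s -> nth 0 (H s) x = nth 0 (H s0) x.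
Proof.
move=> q lt Hb s le; rewrite -(subnK le); elim: (s - s0) => // k IH.
have le' : s0 <= k + s0 by exact: leq_addl.
rewrite addSn run_kept ?IH //; first exact: leq_trans (run_size le').
move=> act; rewrite -IH; apply: Hb => //.
by rewrite leqNgt; apply/negP => /(q _ le'); rewrite act.
Qed.

(** The number [x] itself blocks its block for all programs above [x]. *)
Lemma stable_index x : exists s0, x < size (H s0) /\
  forall s, s0 <= s -> nth 0 (H s) x = nth 0 (H s0) x.
Proof.
have [s1 q] := quiet x.+1; have [s2 lt] := run_unbounded x.+1.
have lt' : x < size (H (maxn s1 s2)) by apply: leq_trans lt (run_size (leq_maxr _ _)).
exists (maxn s1 s2); split=> //; apply: (@stays x.+1) => // [s le|s le lta _].
  by apply: q; apply: leq_trans le; exact: leq_maxl.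
apply/hasP; exists x; first by rewrite mem_iota.
by rewrite erel_refl ?run_dom // (leq_trans lt') // run_size.
Qed.

(** An element [a] blocks the block that covers it for all programs above [a]. *)
Lemma stable_element a : a \in dom A -> exists s0 x, x < size (H s0) /\
  forall s, s0 <= s -> nth 0 (H s) x = a.
Proof.
move=> Aa; have [s1 q] := quiet a.+1.
pose s0 := maxn s1 a.+2.
have in0 : a \in H s0.
  have -> : s0 = s0.-1.+1 by rewrite prednK // leq_max orbT.
  by apply: run_covers => //; rewrite -ltnS prednK leq_max ?leqnn ?orbT.
have lt : index a (H s0) < size (H s0) by rewrite index_mem.
have E : nth 0 (H s0) (index a (H s0)) = a by exact: nth_index.
exists s0, (index a (H s0)); split=> // s le; rewrite -[RHS]E.
apply: (@stays a.+1) => // {le}s le; last first.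
  move=> lta ->; rewrite E; apply/hasP; exists a; first by rewrite mem_iota.
  by rewrite (erel_refl Aa) orbT.
by apply: q; apply: leq_trans le; exact: leq_maxl.
Qed.

Lemma seen_ex (p : nat * nat) : exists s, (p.1 < size (H s)) && (p.2 < size (H s)).
Proof.
have [s] := run_unbounded (maxn p.1 p.2).+1; rewrite gtn_max => lt.
by exists s.
Qed.

Definition seen p := ex_minn (seen_ex p).

(** The relation pulled back along any sequence that is long enough. *)
Definition copy_rel : rel nat := fun x y =>
  erel A (nth 0 (H (seen (x, y))) x) (nth 0 (H (seen (x, y))) y).

Lemma copy_relE s x y : x < size (H s) -> y < size (H s) ->
  copy_rel x y = erel A (nth 0 (H s) x) (nth 0 (H s) y).
Proof.
move=> ltx lty; rewrite /copy_rel /seen; case: ex_minnP => t /= /andP[ltx' lty'] _.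
case: (leqP s t) => le; first by rewrite (run_erel le).
by rewrite (run_erel (ltnW le)).
Qed.

Lemma copy_dom x y : copy_rel x y -> (x \in predT) && (y \in predT).
Proof. by []. Qed.

Lemma copy_equiv : {in predT & &, equivalence_rel copy_rel}.
Proof.
move=> x y z _ _ _; have [s] := run_unbounded (maxn x (maxn y z)).+1.
rewrite !gtn_max => /and3P[ltx lty ltz].
rewrite !(copy_relE (s := s)) //; split; first by rewrite erel_refl // run_dom.
by move/erel_eql.
Qed.

Definition copy : eqstruct := EqStruct copy_dom copy_equiv.

Lemma copy_computable : computable_struct A -> cf H -> computable_struct copy.
Proof.
move=> cA cH; have HE := cf_erel cA; split.
  by exists (const_code 1) => x; exact: computes_const.
have cS : cf seen by apply: cf_min; cf_auto.
have [c Hc] : cf (fun p => nat_of_bool (copy_rel p.1 p.2)).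
  by rewrite /copy_rel; cf_auto.
exists (Comp c [:: cpair_code]) => x y.
by apply: comp1 (Hc (x, y)) _; exact: computes_cpair.
Qed.

Lemma copy_isomorphic : isomorphic copy A.
Proof.
have [h Hh] : exists h, forall x, exists s0, x < size (H s0) /\
    forall s, s0 <= s -> nth 0 (H s) x = h x.
  apply: (functional_choice (fun x y => exists s0, x < size (H s0) /\
    forall s, s0 <= s -> nth 0 (H s) x = y)) => x.
  by have [s0 [lt Hs]] := stable_index x; exists (nth 0 (H s0) x), s0.
have common x y : exists s, [/\ x < size (H s), y < size (H s),
    nth 0 (H s) x = h x & nth 0 (H s) y = h y].
  have [s1 [ltx Hx]] := Hh x; have [s2 [lty Hy]] := Hh y.
  exists (maxn s1 s2); rewrite Hx ?Hy ?leq_maxl ?leq_maxr //; split=> //.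
    by apply: leq_trans ltx (run_size (leq_maxl _ _)).
  by apply: leq_trans lty (run_size (leq_maxr _ _)).
exists h; split.
- by move=> x _; have [s [lt _ <- _]] := common x x; exact: run_dom.
- move=> x y _ _; have [s [ltx lty <- <-]] := common x y => /eqP.
  by have /goodP[u _] := H_good s; rewrite nth_uniq // => /eqP.
- move=> a Aa; have [s0 [x [lt Ha]]] := stable_element Aa.
  exists x => //; have [s1 [_ Hx]] := Hh x.
  by rewrite -(Hx (maxn s0 s1)) ?leq_maxr // Ha // leq_maxl.
move=> x y _ _; have [s [ltx lty <- <-]] := common x y.
by rewrite -(copy_relE ltx lty).
Qed.

(** Consider a late stage that attends to the program [e] of the supposed
isomorphism [f], at which the guess has its final value, [f] has been computed
on the preimages of the candidate list, and no action takes place. The candidate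
is never refuted, so its classes really have at most [n] elements; as [f]
preserves sizes, it is not secured. Since there is no action, all [2e+1]
preimages must then be blocked, but they lie in different blocks. *)
Lemma copy_not_computably_isomorphic : ~ computably_isomorphic copy A.
Proof.
case=> f [fd fi fs fe] [c Hc]; pose e := ecode c.
have Hcf x : computes c [:: x] (f x) by exact: Hc.
have [s1 Hg] := guess_stable e; have [s2 q] := quiet e.+1.
pose i := guess e s1.
have vi s : s1 <= s -> i < s -> valid e s i.
  move=> le; rewrite /i -(Hg _ le) /guess; case: ex_minnP => m /orP[le'|//] _.
  by rewrite ltnNge le'.
pose n := cand_bound i; pose L := cand_list i.
have [nK sL iL _] : [/\ allowed K n, size L = (e + e).+1, indep A L & True].
  by have /and4P[? /eqP ? ? _] := vi (maxn s1 i.+1) (leq_maxl _ _) (leq_maxr _ _).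
have notbig a : a \in L -> ~ big A n.+1 a.
  move=> La [l [ul sl] Hl].
  have [m Hm] : exists m, forall b, b \in l -> b < m.
    elim: (l) => [|b l' [m IH]]; first by exists 0.
    exists (maxn b.+1 m) => d; rewrite inE => /orP[/eqP->|/IH lt].
      by rewrite leq_maxl.
    by rewrite (leq_trans lt) // leq_maxr.
  have /and4P[_ _ _ /allP/(_ a La)] := vi (maxn m (maxn s1 i.+1))
    (leq_trans (leq_maxl _ _) (leq_maxr _ _)) (leq_trans (leq_maxr _ _) (leq_maxr _ _)).
  apply/negP; rewrite -ltnNge -sl -size_filter; apply: uniq_leq_size => // b lb.
  by rewrite mem_filter Hl // mem_iota /= (leq_trans (Hm _ lb)) // leq_maxl.
have [l _ Hl] : exists2 l, (forall x, x \in l -> x \in predT) & map f l = L.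
  apply: preimage_seq => a La; apply: fs.
  by have /andP[/allP + _] := iL; apply.
have [s3 H3] : exists s3, forall x, x \in l -> x < size (H s3) /\ conv s3 e x (f x).
  elim: (l) => [|x l' [s IH]]; first by exists 0.
  have [[t Ht] _] := conv_computes (Hcf x); have [u Hu] := run_unbounded x.+1.
  exists (maxn s (maxn t u)) => y; rewrite inE => /orP[/eqP->|/IH[lt cv]]; split.
  - apply: leq_trans Hu _; apply: run_size.
    by rewrite !leq_max leqnn !orbT.
  - by apply: conv_mono Ht; rewrite !leq_max leqnn orbT.
  - by apply: leq_trans lt _; apply: run_size; exact: leq_maxl.
  by apply: conv_mono cv; exact: leq_maxl.
pose m := maxn (maxn s1 s2) (maxn i.+1 s3).
pose s := cpair e m.
have att : attended s = e by rewrite /attended [dec s](encK (e, m)).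
have ge : m <= s by exact: leq_addl.
move: ge; rewrite !geq_max => /and3P[/andP[le1 le2] lti le3].
have := q s le2; rewrite att ltnSn => /(_ isT); rewrite /acts att.
have -> : guess e s = i by exact: Hg.
have seenl x : x \in l -> x < size (H s) /\ conv s e x (f x).
  move=> /H3[lt cv]; split; first by apply: leq_trans lt (run_size le3).
  exact: conv_mono cv.
rewrite /may_act lti /= negb_and negbK => /orP[/hasP[x]|/hasPn allb].
  rewrite mem_iota /= => ltx /andP[/hasP[a La cv] big].
  have ea : a = f x by have [_ snd] := conv_computes (Hcf x); exact: snd cv.
  apply: (notbig _ La); apply: big_leq big _.
  exists [seq f y | y <- iota 0 (size (H s)) &
    erel A (nth 0 (H s) x) (nth 0 (H s) y)].
    rewrite map_inj_uniq ?filter_uniq ?iota_uniq ?size_map ?size_filter //.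
    by move=> y z; exact: fi.
  move=> _ /mapP[y + ->]; rewrite mem_filter mem_iota /= => /andP[E lty].
  by rewrite ea fe //= (copy_relE ltx lty).
pose Z := [seq nth 0 (H s) r | r <- iota 0 e] ++ iota 0 e.
have tZ x : x \in l -> touched A Z (nth 0 (H s) x).
  move=> lx; have [lt cv] := seenl x lx.
  have Ix : x \in iota 0 (size (H s)) by rewrite mem_iota.
  move: (allb x Ix); rewrite negb_and negbK => /orP[/negP[]|].
    by apply/hasP; exists (f x) => //; rewrite -/L -Hl map_f.
  case/hasP=> r; rewrite mem_iota /= => ltr /orP[E|E]; apply/hasP.
    exists (nth 0 (H s) r) => //; rewrite mem_cat map_f // mem_iota //.
  by exists r => //; rewrite mem_cat mem_iota ltr orbT.
have iX : indep A [seq nth 0 (H s) x | x <- l].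
  apply/andP; split.
    by apply/allP => _ /mapP[x /seenl[lt _] ->]; exact: run_dom.
  have /andP[_] := iL; rewrite -Hl !pairwise_map.
  apply: (sub_in_pairwise _ (allss l)) => x y /seenl[ltx _] /seenl[lty _] /=.
  by rewrite fe //= (copy_relE ltx lty).
have : size [seq nth 0 (H s) x | x <- l] <= size Z.
  by apply: indep_size iX _; rewrite all_map; apply/allP => x; exact: tZ.
by rewrite size_map -(size_map f) Hl sL size_cat size_map !size_iota ltnn.
Qed.

End Run.

Lemma diagonal_copy : computable_struct A -> exists B,
  [/\ computable_struct B, isomorphic B A & ~ computably_isomorphic B A].
Proof.
move=> cA; have [||H [_ H_good H_step cH]] := @cf_search _ _ good step_rel [::].
- by [].
- by move=> s h; exact: step_ex.
exists (copy H_good H_step); split.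
- by apply: copy_computable => //; apply: cH; [exact: cp_good|exact: cp_step].
- exact: copy_isomorphic.
exact: copy_not_computably_isomorphic.
Qed.

End Construction.

Theorem corollary4p2 (A : eqstruct) (hA : computable_struct A) :
  weakly_ultrahomogeneous A <-> computably_categorical A.
Proof.
split=> [|cc]; first exact: weakly_ultrahomogeneous_cc.
apply: NNPP => nwu.
have nu : ~ almost_uniform A by move/almost_uniform_weakly_ultrahomogeneous.
have [K [allowed_spread few_large]] := not_almost_uniform nu.
have [B [cB isoB]] := diagonal_copy allowed_spread few_large hA.
by apply; exact: cc.
Qed.
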